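(* Let $t\geq 2$ and $k\geq 1$ be integers. For every algebraic number $\alpha$ with $0<|\alpha|<1$, the continued fraction $$\frac{H_k(\alpha)}{H_k(\alpha^{t^k})}=a_t(2^k-1;\alpha)+\cfrac{a_t(2^k;\alpha^{t^k})}{a_t(2^k-1;\alpha^{t^k})+\cfrac{a_t(2^k;\alpha^{t^{2k}})}{a_t(2^k-1;\alpha^{t^{2k}})+\cdots+\cfrac{a_t(2^k;\alpha^{t^{nk}})}{a_t(2^k-1;\alpha^{t^{nk}})+\cdots}}}$$ is transcendental.
   Context: Let $t\geq2$ and $k\geq1$ be fixed integers. The (Type 1) Stern polynomials $a_t(n;z)$ are defined by $a_t(0;z)=0$, $a_t(1;z)=1$ and, for $n\geq1$, $$a_t(2n;z)=z\,a_t(n;z^t),\qquad a_t(2n+1;z)=a_t(n+1;z^t)+a_t(n;z^t).$$ Their coefficients are only $0$ or $1$. In particular $$a_t(2^k;z)=z^{\frac{t^k-1}{t-1}},\qquad a_t(2^k-1;z)=\sum_{i=1}^{k}z^{\frac{t^k-t^i}{t-1}}.$$ For $n\geq0$ put $$\alpha_n=\alpha_n(k)=\frac{2^{kn}-(-1)^n}{2^k+1}\in\mathbb{Z}.$$ The polynomials $a_t(\alpha_{n+1};z)$ and $a_t(\alpha_n;z)$ agree to ever higher powers of $z$ as $n$ grows (known result of Dilcher and Eriksen), so the limit $$H_k(z)=\lim_{n\to\infty}a_t(\alpha_n;z)$$ exists; it is a power series converging in $|z|<1$ whose coefficients are only $0$ or $1$ (it depends on $t$ as well as on $k$). It satisfies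 (known) $$H_k(z)=a_t(2^k-1;z)H_k(z^{t^k})+a_t(2^k;z^{t^k})H_k(z^{t^{2k}}),$$ which generates the (known) infinite continued fraction expansion of $H_k(z)/H_k(z^{t^k})$, namely the one displayed in the claim with $z$ in place of $\alpha$, convergent in $|z|<1$. The value of the infinite continued fraction is the limit of its finite truncations. *)

(* Defs.v *)
From HB Require Import structures.
From mathcomp Require Import all_boot all_order all_algebra.
From mathcomp Require Import all_classical all_reals all_analysis.
From mathcomp Require Export complex.
From mathcomp Require Import zify.

Set Implicit Arguments.
Unset Strict Implicit.
Unset Printing Implicit Defensive.

Import Order.TTheory GRing.Theory Num.Theory.
Import numFieldNormedType.Exports.

Local Open Scope classical_set_scope.
Local Open Scope ring_scope.

(* [fuel] only bounds the recursion depth; the defining recurrences are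
   [stern0], [stern1], [stern_even] and [stern_odd] below. *)
Fixpoint stern_rec (t fuel n : nat) : {poly int} :=
  if fuel is f.+1 then
    if (n <= 1)%N then n%:R
    else if odd n then
      (stern_rec t f n./2.+1 \Po 'X^t) + (stern_rec t f n./2 \Po 'X^t)
    else 'X * (stern_rec t f n./2 \Po 'X^t)
  else 0.

Definition stern (t n : nat) : {poly int} := stern_rec t n n.

Lemma stern_rec_fuel (t f n : nat) : (n <= f)%N -> stern_rec t f n = stern t n.
Proof.
rewrite /stern.
elim/ltn_ind: f n => -[|f] IH n; first by rewrite leqn0 => /eqP ->.
case: n => [|n] // le_nf; rewrite /=.
case: ifP => // n_gt1.
have e1 m : (m <= n)%N -> stern_rec t f m = stern_rec t n m.
  move=> le_mn; rewrite [LHS]IH; [|lia..].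
  by rewrite [RHS]IH; [|lia..].
by case: ifP => n_odd; rewrite !e1 //; lia.
Qed.

Lemma sternE (t n : nat) : (1 < n)%N ->
  stern t n =
    if odd n then (stern t n./2.+1 \Po 'X^t) + (stern t n./2 \Po 'X^t)
    else 'X * (stern t n./2 \Po 'X^t).
Proof.
case: n => // n n_gt1; rewrite {1}/stern /= leqNgt n_gt1 /=.
by case: ifP => n_odd; rewrite !stern_rec_fuel //; lia.
Qed.

Lemma stern0 (t : nat) : stern t 0 = 0. Proof. by []. Qed.

Lemma stern1 (t : nat) : stern t 1 = 1. Proof. by []. Qed.

Lemma stern_even (t n : nat) : (1 <= n)%N ->
  stern t (2 * n) = 'X * (stern t n \Po 'X^t).
Proof.
move=> n_gt0; rewrite sternE; last by lia.
by rewrite mul2n odd_double doubleK.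
Qed.

Lemma stern_odd (t n : nat) : (1 <= n)%N ->
  stern t (2 * n + 1) = (stern t (n + 1) \Po 'X^t) + (stern t n \Po 'X^t).
Proof.
move=> n_gt0; rewrite !addn1 sternE; last by lia.
by rewrite mul2n /= odd_double /= uphalf_double.
Qed.

(* The division is exact and the quotient is nonnegative: see [alphanE]. *)
Definition alphan (k n : nat) : nat :=
  `|((2 ^+ (k * n) - (-1) ^+ n : int) %/ (2 ^+ k + 1))%Z|%N.

Lemma alphanE (k n : nat) :
  (alphan k n)%:Z * (2 ^+ k + 1) = 2 ^+ (k * n) - (-1) ^+ n.
Proof.
have d_gt0 : 0 < 2 ^+ k + 1 :> int by rewrite addr_gt0 ?exprn_gt0.
have dvd : (2 ^+ k + 1 %| (2 ^+ (k * n) - (-1) ^+ n : int))%Z.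
  by rewrite exprM subrXX opprK dvdz_mulr.
have ge0 : 0 <= 2 ^+ (k * n) - (-1) ^+ n :> int.
  rewrite subr_ge0 (@le_trans _ _ 1) ?exprn_ege1 //.
  by rewrite -signr_odd; case: (odd n).
rewrite /alphan abszE ger0_norm ?divzK //.
by rewrite divz_ge0.
Qed.

Definition stern_at (C : numFieldType) (t n : nat) (z : C) : C :=
  (map_poly intr (stern t n)).[z].

Definition Hk (C : numFieldType) (t k : nat) (z : C) : C :=
  lim (stern_at t (alphan k n) z @[n --> \oo]).

(* Truncation
     a 0 + b 1 / (a 1 + b 2 / (a 2 + ... + b n / a n));
   the value [b 0] is not used. *)
Fixpoint cfrac (C : numFieldType) (a b : nat -> C) (n : nat) : C :=
  if n is m.+1 then
    a 0%N + b 1%N / cfrac (fun i => a i.+1) (fun i => b i.+1) m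
  else a 0%N.

(* No denominator occurring in the [n]-th truncation vanishes. *)
Fixpoint cfrac_defined (C : numFieldType) (a b : nat -> C) (n : nat) : Prop :=
  if n is m.+1 then
    cfrac (fun i => a i.+1) (fun i => b i.+1) m != 0 /\
    cfrac_defined (fun i => a i.+1) (fun i => b i.+1) m
  else True.

(* As division is total, convergence of the truncations alone could be an
   artefact of [x / 0 = 0]; finitely many truncations may be undefined. *)
Definition cfrac_value (C : numFieldType) (a b : nat -> C) (x : C) : Prop :=
  (\forall n \near \oo, cfrac_defined a b n) /\ cfrac a b n @[n --> \oo] --> x.

Definition transcendental (C : numFieldType) (x : C) : Prop :=
  ~ algebraicOver (@ratr C) x.

(* Main.v *)
Require Import Defs.
From HB Require Import structures.
From mathcomp Require Import all_boot all_order all_algebra all_fingroup all_field.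
From mathcomp Require Import all_classical all_reals all_analysis.
From mathcomp Require Import complex.
From mathcomp Require Import zify ring.

Set Implicit Arguments.
Unset Strict Implicit.
Unset Printing Implicit Defensive.

Import Order.TTheory GRing.Theory Num.Theory.
Import numFieldNormedType.Exports.

Local Open Scope ring_scope.

(** Write T for t^k and let A(z) be the matrix with rows (a_t(2^k-1; z), z^e) and
    (1, 0), where z^e is the monomial a_t(2^k; z^T). The functional equation
    says that the vector (H(z), H(z^T)) is A(z) times (H(z^T), H(z^(T^2))). All
    three claims follow from one statement, [Hk_independent]: for algebraic
    alpha with 0 < |alpha| < 1, no nonzero linear form with algebraic
    coefficients vanishes at (H(alpha), H(alpha^T)). It is proved by Mahler's
    method, in the homogeneous form that suits a ratio of two values.

    The input from algebra is that H(z)/H(z^T) is transcendental over Q(z)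
    ([no_relation]). Let F be a binary form over Q[z] of least degree d that
    vanishes at (H(z), H(z^T)). The functional equation and minimality make F
    semi-invariant: F(z; A(z)w) is a multiple of F(z^T; w). Call a point rho
    singular when F(rho; .) has a multiple zero. By semi-invariance every T-th
    root of a nonzero singular point is singular, so, there being only finitely
    many singular points, none of them is nonzero ([not_singular]). At the fixed
    point 1 of z -> z^T, F(1; .) is therefore squarefree and semi-invariant
    under A(1), whose eigenvalues are irrational, with a ratio of absolute value
    other than 1. This leaves at most the two eigendirections as zeros, so d is
    at most 2. If d = 1 an eigenvalue would be rational. If d = 2 the
    discriminant of F has no nonzero root, hence is a monomial; it is moreover
    the square of a power series, so F splits over Q[z], against minimality.

    For the arithmetic, suppose that (H(alpha), H(alpha^T)) is proportional to an
    algebraic vector beta. Linear algebra gives, for each N, a form p of degree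
    N with coefficients of degree at most N in z such that
    E(z) = p(z; H(z), H(z^T)) has order v >= N^2 at 0, and v is finite by
    [no_relation] ([hform_auxiliary]). Along the orbit z_n = alpha^(T^n) the
    number E(z_n) is nonzero for large n and at most of the order of
    |alpha|^(N^2 T^n) ([hfun_bounds]). Pulling back by the matrices A(z_i), it is
    also, up to a bounded factor, a polynomial expression in alpha and beta of
    degree O(N T^n), so by a Liouville inequality ([irep_lower_bound]) it is at
    least G^(-N T^n) with G independent of N. For large N these two bounds
    contradict each other ([Mahler_contradiction]).

    Heights are replaced by integer matrices: alpha and beta act on a lattice of
    finite rank, a polynomial expression in them is an eigenvalue of an integer
    matrix with controlled entries, and a nonzero eigenvalue cannot be small
    because the lowest nonzero coefficient of the characteristic polynomial is
    an integer.

    Finally, the truncations of the continued fraction are the quotients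
    h_(n+2)(alpha)/h_(n+1)(alpha^T) of the approximating polynomials
    h_n = a_t(alpha_n; .), as soon as their denominators do not vanish
    ([cfrac_hval]); that they do not, for large n, follows from the nonvanishing
    of H on the orbit of alpha. *)

(** * Orders of vanishing *)

Section Zord.
Variable A : comNzRingType.
Implicit Types (p q : {poly A}) (m n : nat).

(** A predicate rather than a valuation, so that 0 needs no infinite order. *)
Definition zord m p := forall i, (i < m)%N -> p`_i = 0.

Lemma zordW m n p : (m <= n)%N -> zord n p -> zord m p.
Proof. by move=> mn zp i im; apply/zp/(leq_trans im). Qed.

Lemma zordP m p : zord m p <-> exists q, p = 'X^m * q.
Proof.
split=> [zp|[q ->] i im]; last by rewrite coefXnM im.
exists (drop_poly m p); rewrite -{1}(poly_take_drop m p) mulrC.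
suff -> : take_poly m p = 0 by rewrite add0r.
by apply/polyP=> i; rewrite coef_take_poly coef0; case: ifP => // /zp.
Qed.

Lemma zord0 m : zord m 0. Proof. by move=> i _; rewrite coef0. Qed.

Lemma zordD m p q : zord m p -> zord m q -> zord m (p + q).
Proof. by move=> zp zq i im; rewrite coefD zp ?zq ?addr0. Qed.

Lemma zordM m n p q : zord m p -> zord n q -> zord (m + n) (p * q).
Proof.
move=> /zordP[p' ->] /zordP[q' ->]; apply/zordP; exists (p' * q').
by rewrite exprD; ring.
Qed.

Lemma zordMl m p q : zord m q -> zord m (p * q).
Proof. by move=> zq; rewrite -[m]add0n; apply: zordM. Qed.

Lemma zordMr m p q : zord m p -> zord m (p * q).
Proof. by move=> zp; rewrite mulrC; apply: zordMl. Qed.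

Lemma coef_zordM m n p q : zord m p -> zord n q ->
  (p * q)`_(m + n) = p`_m * q`_n.
Proof.
move=> /zordP[p' ->] /zordP[q' ->].
rewrite mulrACA -exprD !coefXnM !ltnn !subnn.
by rewrite coefM big_ord_recl big_ord0 addr0.
Qed.

Lemma zord_comp m T p : zord m p -> zord (T * m) (p \Po 'X^T).
Proof.
move=> /zordP[q ->]; rewrite rmorphM rmorphXn /= comp_polyX -exprM.
by apply/zordP; eexists.
Qed.

Lemma coef0_comp T p : (0 < T)%N -> (p \Po 'X^T)`_0 = p`_0.
Proof.
by move=> T0; rewrite -!horner_coef0 horner_comp hornerXn expr0n; case: T T0.
Qed.
End Zord.

Section ZordField.
Variable F : fieldType.
Implicit Types (p q : {poly F}).

(** A power series with nonzero constant term is a unit. *)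
Lemma zordKl m p q : p`_0 != 0 -> zord m (p * q) -> zord m q.
Proof.
move=> p0 zpq; elim/ltn_ind=> i IH im; have := zpq i im.
rewrite coefM big_ord_recl subn0 big1 => [|j _].
  by rewrite addr0 => /eqP; rewrite mulf_eq0 (negPf p0) => /eqP.
by rewrite IH ?mulr0 // lift0; case: i {IH} im j => [|i] im [j jP] //=; lia.
Qed.
End ZordField.

(** * Power series as limits of polynomials *)

Section Coherent.
Variable F : fieldType.
Implicit Types u v : nat -> {poly F}.

(** A power series is represented by a sequence of polynomials that is Cauchy for
    the z-adic topology; it is zero when the sequence is null. *)
Definition zadic_null u := forall m, exists N, forall n, (N <= n)%N -> zord m (u n).

Definition zadic_cauchy u :=
  forall m, exists N, forall n, (N <= n)%N -> zord m (u n.+1 - u n).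

Lemma zadic_nullS u : zadic_null (fun n => u n.+1) <-> zadic_null u.
Proof.
split=> zu m; have [N zN] := zu m; last first.
  by exists N => n Nn; apply: zN; lia.
by exists N.+1 => -[|n] // Nn; apply: zN.
Qed.

Lemma zadic_nullD u v : zadic_null u -> zadic_null v -> zadic_null (fun n => u n + v n).
Proof.
move=> zu zv m; have [N zN] := zu m; have [N' zN'] := zv m.
by exists (maxn N N') => n Nn; apply: zordD; [apply: zN|apply: zN']; lia.
Qed.

Lemma zadic_nullM u v : zadic_null v -> zadic_null (fun n => u n * v n).
Proof. by move=> zv m; have [N zN] := zv m; exists N => n /zN/zordMl. Qed.

Lemma zadic_null_comp T u : (0 < T)%N -> zadic_null u -> zadic_null (fun n => u n \Po 'X^T).
Proof.
move=> T0 zu m; have [N zN] := zu m; exists N => n /zN/(zord_comp (T := T)).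
by apply: zordW; rewrite leq_pmull.
Qed.

Lemma zadic_nullKl u v : (forall n, (u n)`_0 != 0) ->
  zadic_null (fun n => u n * v n) -> zadic_null v.
Proof. by move=> u0 zuv m; have [N zN] := zuv m; exists N => n /zN/zordKl; apply. Qed.

Lemma zadic_cauchyC c : zadic_cauchy (fun=> c).
Proof. by move=> m; exists 0%N => n _; rewrite subrr; apply: zord0. Qed.

Lemma zadic_cauchyD u v : zadic_cauchy u -> zadic_cauchy v -> zadic_cauchy (fun n => u n + v n).
Proof.
move=> zu zv m; have [N zN] := zu m; have [N' zN'] := zv m.
exists (maxn N N') => n Nn; rewrite opprD addrACA.
by apply: zordD; [apply: zN|apply: zN']; lia.
Qed.

Lemma zadic_cauchyM u v : zadic_cauchy u -> zadic_cauchy v -> zadic_cauchy (fun n => u n * v n).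
Proof.
move=> zu zv m; have [N zN] := zu m; have [N' zN'] := zv m.
exists (maxn N N') => n Nn.
have -> : u n.+1 * v n.+1 - u n * v n =
  u n.+1 * (v n.+1 - v n) + (u n.+1 - u n) * v n by ring.
by apply: zordD; [apply/zordMl/zN'|apply/zordMr/zN]; lia.
Qed.

Lemma zadic_cauchyX u k : zadic_cauchy u -> zadic_cauchy (fun n => u n ^+ k).
Proof.
move=> cu; elim: k => [|k IH]; first exact: zadic_cauchyC.
under [X in zadic_cauchy X]funext => n do rewrite exprS.
exact: zadic_cauchyM.
Qed.

Lemma zadic_cauchy_sum (k : nat) (w : 'I_k -> nat -> {poly F}) :
  (forall i, zadic_cauchy (w i)) -> zadic_cauchy (fun n => \sum_(i < k) w i n).
Proof.
elim: k w => [|k IH] w cw.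
  under [X in zadic_cauchy X]funext => n do rewrite big_ord0.
  exact: zadic_cauchyC.
under [X in zadic_cauchy X]funext => n do rewrite big_ord_recl.
by apply: zadic_cauchyD => //; apply: IH.
Qed.

Lemma zadic_cauchy_comp T u : (0 < T)%N ->
  zadic_cauchy u -> zadic_cauchy (fun n => u n \Po 'X^T).
Proof.
move=> T0 zu m; have [N zN] := zu m; exists N => n /zN zn.
by rewrite -comp_polyB; apply/(zordW _ (zord_comp zn)); rewrite leq_pmull.
Qed.

(** Coefficients of bounded index are eventually constant, so a Cauchy sequence
    that is not null ends up with a fixed order and a fixed leading coefficient. *)
Lemma zadic_cauchy_val u : zadic_cauchy u -> ~ zadic_null u ->
  exists m e N, e != 0 /\
    forall n, (N <= n)%N -> zord m (u n) /\ (u n)`_m = e.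
Proof.
move=> cu /existsNP[m /forallNP nz]; have [N0 cN] := cu m.
have /existsNP[n0 /not_implyP[Nn0 /existsNP[i /not_implyP[im /eqP ui]]]] := nz N0.
have exi : exists i, (u n0)`_i != 0 by exists i.
have [v uv vmin] := ex_minnP exi.
have cst n : (n0 <= n)%N -> forall j, (j < m)%N -> (u n)`_j = (u n0)`_j.
  elim: n => [|n IH]; first by rewrite leqn0 => /eqP ->.
  rewrite leq_eqVlt => /predU1P[<-//|]; rewrite ltnS => n0n j jm.
  have /(_ _ jm) := cN n (leq_trans Nn0 n0n).
  by rewrite coefB => /eqP; rewrite subr_eq0 => /eqP ->; apply: IH.
have vm : (v < m)%N by apply: leq_ltn_trans im; apply: vmin.
exists v, (u n0)`_v, n0; split=> // n n0n; split; last exact: cst.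
move=> j jv; rewrite cst ?(ltn_trans jv) //; apply: contraTeq jv => uj.
by rewrite -leqNgt vmin.
Qed.

(** Orders of vanishing add up and leading coefficients multiply: power series
    form an integral domain. *)
Lemma zadic_null_domain u v : zadic_cauchy u -> zadic_cauchy v ->
  zadic_null (fun n => u n * v n) -> zadic_null u \/ zadic_null v.
Proof.
move=> cu cv zuv; apply: contrapT => /not_orP[nu nv].
have [m [e [N [e0 uN]]]] := zadic_cauchy_val cu nu.
have [m' [e' [N' [e'0 vN]]]] := zadic_cauchy_val cv nv.
have [N'' zN] := zuv (m + m').+1.
pose n := maxn N (maxn N' N'').
have /uN[zu ue] : (N <= n)%N by lia.
have /vN[zv ve] : (N' <= n)%N by lia.
have /zN/(_ (m + m')%N (ltnSn _))/eqP : (N'' <= n)%N by lia.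
by rewrite coef_zordM // ue ve mulf_eq0 (negPf e0) (negPf e'0).
Qed.
End Coherent.

(** * Binary forms *)

Section Forms.
Variable A : comNzRingType.
Implicit Types (p q : {poly A}) (x y : A).

(** A binary form is stored as the polynomial obtained by setting its second
    variable to 1. The degree is a separate argument because the coefficient of
    the top power of the first variable may be 0. *)
Definition form_eval d p x y := \sum_(i < d.+1) p`_i * x ^+ i * y ^+ (d - i).

Lemma form_evalD d p q x y : form_eval d (p + q) x y = form_eval d p x y + form_eval d q x y.
Proof. by rewrite /form_eval -big_split; apply: eq_bigr => i _; rewrite coefD !mulrDl. Qed.

Lemma form_eval0 d x y : form_eval d 0 x y = 0.
Proof. by rewrite /form_eval big1 // => i _; rewrite coef0 !mul0r. Qed.

Lemma form_eval_sum d I (r : seq I) (P : pred I) (f : I -> {poly A}) x y :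
  form_eval d (\sum_(i <- r | P i) f i) x y = \sum_(i <- r | P i) form_eval d (f i) x y.
Proof.
elim/big_ind2: _ => [|? ? ? ? <- <-|//]; first exact: form_eval0.
exact: form_evalD.
Qed.

Lemma form_evalZ d c p x y : form_eval d (c *: p) x y = c * form_eval d p x y.
Proof. by rewrite /form_eval mulr_sumr; apply: eq_bigr => i _; rewrite coefZ !mulrA. Qed.

Lemma form_evalN d p x y : form_eval d (- p) x y = - form_eval d p x y.
Proof. by rewrite -scaleN1r form_evalZ mulN1r. Qed.

Lemma form_evalXn d i x y : (i <= d)%N -> form_eval d 'X^i x y = x ^+ i * y ^+ (d - i).
Proof.
rewrite -ltnS => id; rewrite /form_eval (bigD1 (Ordinal id)) //= coefXn eqxx mul1r.
rewrite big1 ?addr0 // => j; rewrite -val_eqE /= coefXn => /negPf ->.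
by rewrite !mul0r.
Qed.

Lemma form_eval_scale d p k x y : form_eval d p (k * x) (k * y) = k ^+ d * form_eval d p x y.
Proof.
rewrite /form_eval mulr_sumr; apply: eq_bigr => i _.
have -> : k ^+ d = k ^+ i * k ^+ (d - i).
  by rewrite -exprD subnKC // -ltnS.
by rewrite !exprMn mulrACA !mulrA; congr (_ * _); congr (_ * _); rewrite -!mulrA;
  rewrite [RHS]mulrC [k ^+ (d - i) * _]mulrC !mulrA.
Qed.

Lemma form_eval1 d p x : (size p <= d.+1)%N -> form_eval d p x 1 = p.[x].
Proof.
by move=> sp; rewrite /form_eval (horner_coef_wide _ sp); apply: eq_bigr => i _;
  rewrite expr1n mulr1.
Qed.

Lemma form_eval_line d p r y : (size p <= d.+1)%N -> form_eval d p (r * y) y = y ^+ d * p.[r].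
Proof.
move=> sp; have := form_eval_scale d p y r 1; rewrite form_eval1 // mulr1 => <-.
by rewrite mulrC.
Qed.

Lemma form_evalS d p x y : (size p <= d.+1)%N -> form_eval d.+1 p x y = y * form_eval d p x y.
Proof.
move=> sp; rewrite /form_eval big_ord_recr /= nth_default // !mul0r addr0 mulr_sumr.
by apply: eq_bigr => i _; rewrite subSn ?exprS 1?mulrCA // -ltnS.
Qed.

Lemma form_eval_quadratic p x y :
  form_eval 2 p x y = p`_0 * y ^+ 2 + p`_1 * x * y + p`_2 * x ^+ 2.
Proof.
rewrite /form_eval !big_ord_recl big_ord0 addr0 addrA /bump /=.
by rewrite subn0 subnn !expr0 !expr1 !mulr1.
Qed.

(** Both sides are bilinear in the coefficients, so monomials decide. *)
Lemma form_evalM m n p q x y : (size p <= m.+1)%N -> (size q <= n.+1)%N ->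
  form_eval (m + n) (p * q) x y = form_eval m p x y * form_eval n q x y.
Proof.
move=> sp sq; rewrite -{1}(coefK p) -{1}(coefK q) !poly_def.
rewrite (big_ord_widen_cond _ xpredT (fun i => p`_i *: 'X^i) sp) big_mkcondr /=.
rewrite (big_ord_widen_cond _ xpredT (fun i => q`_i *: 'X^i) sq) big_mkcondr /=.
rewrite mulr_suml; etransitivity; first exact: form_eval_sum.
rewrite [X in _ = X * _]/form_eval mulr_suml; apply: eq_bigr => i _.
rewrite mulr_sumr; etransitivity; first exact: form_eval_sum.
rewrite [X in _ = _ * X]/form_eval mulr_sumr; apply: eq_bigr => j _.
case: ifP => [_|/negbT];
  last by rewrite -leqNgt => /(nth_default 0) ->; rewrite mul0r form_eval0 !mul0r.
case: ifP => [_|/negbT];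
  last by rewrite -leqNgt => /(nth_default 0) ->; rewrite mulr0 form_eval0 !mul0r mulr0.
rewrite -scalerAl -scalerAr -exprD !form_evalZ form_evalXn; last first.
  by have := ltn_ord i; have := ltn_ord j; clear; lia.
have -> : (m + n - (i + j) = (m - i) + (n - j))%N.
  by have := ltn_ord i; have := ltn_ord j; clear; lia.
rewrite !exprD; set a := x ^+ i; set b := x ^+ j; set c := y ^+ (m - i).
set d := y ^+ _; ring.
Qed.

Lemma form_eval_exp m n p x y : (size p <= m.+1)%N ->
  form_eval (m * n) (p ^+ n) x y = form_eval m p x y ^+ n /\ (size (p ^+ n) <= (m * n).+1)%N.
Proof.
move=> sp; elim: n => [|n [IH sn]].
  by rewrite muln0 !expr0 /form_eval big_ord1 coef1 !mul1r size_poly1.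
rewrite mulnS !exprS form_evalM // IH; split=> //.
apply: leq_trans (size_polyMleq _ _) _; lia.
Qed.

End Forms.

(** The substitution (x, y) -> (a x + b y, c x + e y), again with the second
    variable set to 1. *)
Definition form_subst (A : comNzRingType) d (p : {poly A}) (a b c e : A) : {poly A} :=
  form_eval d (map_poly polyC p) (a *: 'X + b%:P) (c *: 'X + e%:P).

Lemma map_form_eval (A B : comNzRingType) (f : {rmorphism A -> B}) d (p : {poly A}) x y :
  f (form_eval d p x y) = form_eval d (map_poly f p) (f x) (f y).
Proof.
rewrite /form_eval rmorph_sum; apply: eq_bigr => i _.
by rewrite !rmorphM !rmorphXn coef_map.
Qed.

Lemma horner_form_eval (A : comNzRingType) d (p : {poly A}) (x y : {poly A}) t :
  (form_eval d (map_poly polyC p) x y).[t] = form_eval d p x.[t] y.[t].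
Proof.
rewrite -/(horner_eval t _) map_form_eval -map_poly_comp map_poly_id // => z _.
by rewrite /= /horner_eval hornerC.
Qed.

Section Subst.
Variable A : comNzRingType.
Implicit Types (p q : {poly A}) (x y : A).

Lemma size_linear (a b : A) : (size (a *: 'X + b%:P)%R <= 2)%N.
Proof.
apply: leq_trans (size_polyD _ _) _; rewrite geq_max.
rewrite (leq_trans (size_scale_leq _ _)) ?size_polyX //.
by rewrite (leq_trans (size_polyC_leq1 _)).
Qed.

Lemma form_eval_linear (a b x y : A) : form_eval 1 (a *: 'X + b%:P) x y = a * x + b * y.
Proof.
rewrite /form_eval !big_ord_recl big_ord0 !coefD !coefZ !coefX !coefC /=.
by rewrite subn0 expr0; ring.
Qed.

Lemma size_form_subst d p a b c e : (size (form_subst d p a b c e) <= d.+1)%N.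
Proof.
rewrite /form_subst /form_eval; apply: (leq_trans (size_sum _ _ _)); apply/bigmax_leqP=> i _.
rewrite coef_map /= -mulrA mul_polyC.
apply: (leq_trans (size_scale_leq _ _)).
apply: (leq_trans (size_polyMleq _ _)).
have [_ s1] := form_eval_exp i 0 0 (size_linear a b).
have [_ s2] := form_eval_exp (d - i) 0 0 (size_linear c e).
rewrite -subn1 leq_subLR; apply: leq_trans (leq_add s1 s2) _.
by have := ltn_ord i; clear; lia.
Qed.

Lemma form_eval_subst d p a b c e x y :
  form_eval d (form_subst d p a b c e) x y = form_eval d p (a * x + b * y) (c * x + e * y).
Proof.
rewrite {1}/form_subst {2}/form_eval form_eval_sum {2}/form_eval; apply: eq_bigr => i _.
rewrite coef_map /= -mulrA mul_polyC form_evalZ -mulrA.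
have [e1 s1] := form_eval_exp i x y (size_linear a b).
have [e2 s2] := form_eval_exp (d - i) x y (size_linear c e).
rewrite -(form_eval_linear a b) -(form_eval_linear c e) -e1 -e2 -form_evalM //.
by rewrite !mul1n subnKC // -ltnS.
Qed.
End Subst.

Lemma map_form_subst (A B : comNzRingType) (f : {rmorphism A -> B}) d (p : {poly A})
    a b c e :
  map_poly f (form_subst d p a b c e) = form_subst d (map_poly f p) (f a) (f b) (f c) (f e).
Proof.
rewrite /form_subst map_form_eval /= -!map_poly_comp /=.
by rewrite !rmorphD /= !map_polyZ !map_polyX !map_polyC; congr form_eval;
  apply/eq_map_poly => z /=; rewrite map_polyC.
Qed.

(** * Primitive parts and a quadratic irrationality *)

(** Induction with a Bezout relation between the head and the content of the
    tail. Primitivity is expressed by a Bezout relation because that form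
    survives every specialization of the variable and the substitution of
    a power of it. *)
Lemma primitive_part (F : fieldType) (s : seq {poly F}) :
  has (fun x => x != 0) s ->
  exists c q (u : nat -> {poly F}), [/\ c != 0, size q = size s, s = [seq c * x | x <- q] &
    \sum_(i < size q) u i * q`_i = 1].
Proof.
elim: s => //= x s IH; case hs: (has _ s) => nz; last first.
  have x0 : x != 0 by rewrite orbF in nz.
  exists x, (1 :: nseq (size s) 0), (fun i => (i == 0%N)%:R).
  split=> //=; first by rewrite size_nseq.
    rewrite mulr1; congr cons; move/negbT: hs; rewrite -all_predC => /allP zs.
    rewrite map_nseq mulr0; apply: (@eq_from_nth _ 0); rewrite ?size_nseq // => i si.
    by rewrite nth_nseq si; apply/eqP/negPn/(zs (s`_i))/mem_nth.
  rewrite big_ord_recl /= big1 ?addr0 ?mulr1 // => i _.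
  by rewrite mul0r.
have [c [q [u [c0 sq sE uq]]]] := IH hs.
have [uv] := Bezoutp x c.
have [a [b ->]] : exists a b : {poly F}, uv = (a, b) by exists uv.1, uv.2; case: uv.
rewrite /=; set g : {poly F} := a * x + b * c => ab.
have g0 : g != 0.
  apply: contraTneq ab => ->; rewrite eqp_sym eqp0 gcdp_eq0 (negPf c0) andbF //.
have gx : g %| x by rewrite (eqp_dvdl _ ab) dvdp_gcdl.
have gc : g %| c by rewrite (eqp_dvdl _ ab) dvdp_gcdr.
exists g, ((x %/ g) :: [seq (c %/ g) * y | y <- q]).
exists (fun i => if i is j.+1 then b * u j else a); split=> //=.
- by rewrite size_map sq.
- rewrite [g * _]mulrC divpK //; congr cons; rewrite {1}sE -map_comp.
  by apply: eq_map => y /=; rewrite mulrA [g * _]mulrC divpK.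
rewrite big_ord_recl /= size_map.
rewrite (eq_bigr (fun i : 'I_(size q) => (b * (c %/ g)) * (u i * q`_i))) => [|i _]; last first.
  by rewrite (nth_map 0) // ?add0n // mulrACA.
rewrite -mulr_sumr uq mulr1; apply: (mulIf g0).
by rewrite mulrDl -!mulrA !divpK // mul1r.
Qed.

(** A rational root of a monic polynomial is an integer, and it divides the
    constant term -1. *)
Lemma unit_quadratic_irrational (s : nat) (q : rat) :
  (0 < s)%N -> q ^+ 2 != s%:R * q + 1.
Proof.
move=> s0; apply/eqP => eq_q.
have d0 : (denq q)%:~R != 0 :> rat by rewrite intr_eq0 denq_neq0.
pose n := numq q; pose m := denq q.
have qE : q * m%:~R = n%:~R by rewrite -{1}(divq_num_den q) divfK.
have E : n ^+ 2 = s%:Z * n * m + m ^+ 2.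
  apply: (@intr_inj rat); rewrite rmorphD !rmorphXn /= !intrM -qE exprMn eq_q.
  rewrite -pmulrn; ring.
have cop := coprime_num_den q.
have m1 : m = 1.
  have : (m %| n ^+ 2)%Z by rewrite E rpredD ?dvdz_mull // dvdz_exp.
  move=> /dvdzP[k nE]; have : (`|m| %| `|n| ^ 2)%N.
    by rewrite -abszX nE abszM dvdn_mull.
  move=> /gcdn_idPl; have : coprime `|m| (`|n| ^ 2) by rewrite coprimeXr // coprime_sym.
  by rewrite /coprime => /eqP ->; have := denq_gt0 q; rewrite -/m; lia.
rewrite m1 in E.
have : (n %| 1)%Z.
  apply/dvdzP; exists (n - s%:Z).
  by rewrite mulrC mulrBr -expr2 E; ring.
rewrite dvdz1 => /eqP n1.
have [ne|ne] : n = 1 \/ n = -1 by lia.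
  by move: E; rewrite ne; lia.
by move: E; rewrite ne; lia.
Qed.

(** * The relation of least degree *)

Section Relations.
Implicit Types p q r : {poly {poly rat}}.
Variables (T : nat) (a : {poly rat}) (e : nat) (h : nat -> {poly rat}).
Hypothesis T_gt0 : (0 < T)%N.
Hypothesis h_rec : forall n,
  h n.+2 = a * (h n.+1 \Po 'X^T) + 'X^e * ((h n \Po 'X^T) \Po 'X^T).
Hypothesis h_coef0 : forall n, (h n.+1)`_0 = 1.
Hypothesis h_cauchy : zadic_cauchy h.

(** The approximations of H(z) and H(z^T); the shift of the index makes both
    constant terms equal to 1. *)
Definition xseq n := h n.+2.
Definition yseq n := h n.+1 \Po 'X^T.

Definition relation d (p : {poly {poly rat}}) :=
  zadic_null (fun n => form_eval d p (xseq n) (yseq n)).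

Lemma yseq_coef0 n : (yseq n)`_0 = 1.
Proof. by rewrite coef0_comp // h_coef0. Qed.

Lemma xseqS n : xseq n.+1 = a * (xseq n \Po 'X^T) + 'X^e * (yseq n \Po 'X^T).
Proof. exact: h_rec. Qed.

Lemma yseqS n : yseq n.+1 = xseq n \Po 'X^T. Proof. by []. Qed.

Lemma zadic_cauchy_form_eval d p : zadic_cauchy (fun n => form_eval d p (xseq n) (yseq n)).
Proof.
have cS (u : nat -> {poly rat}) : zadic_cauchy u -> zadic_cauchy (fun n => u n.+1).
  by move=> cu m; have [N uN] := cu m; exists N => n Nn; apply: uN; lia.
apply: zadic_cauchy_sum => i; apply: zadic_cauchyM; first apply: zadic_cauchyM.
- exact: zadic_cauchyC.
- by apply: zadic_cauchyX; apply: (cS (fun n => h n.+1)); apply: cS.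
- by apply: zadic_cauchyX; apply: zadic_cauchy_comp => //; apply: cS.
Qed.

(** The second argument is a power series with constant term 1, so one factor of
    it can be cancelled. *)
Lemma relation_lower d p : (size p <= d.+1)%N -> relation d.+1 p -> relation d p.
Proof.
move=> sp rp; apply: (@zadic_nullKl _ yseq) => [n|]; first by rewrite yseq_coef0 oner_eq0.
by move=> m; have [N zN] := rp m; exists N => n /zN; rewrite form_evalS.
Qed.

Lemma relation_mul d d' p q : (size p <= d.+1)%N -> (size q <= d'.+1)%N ->
  relation (d + d') (p * q) -> relation d p \/ relation d' q.
Proof.
move=> sp sq r; apply: zadic_null_domain; try exact: zadic_cauchy_form_eval.
by move=> m; have [N zN] := r m; exists N => n /zN; rewrite form_evalM.
Qed.

Lemma relation_cancel d c p : c != 0 -> relation d (c *: p) -> relation d p.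
Proof.
move=> c0 r.
have [|zc|//] := @zadic_null_domain _ (fun=> c) _
  (@zadic_cauchyC _ c) (@zadic_cauchy_form_eval d p).
  by move=> m; have [N zN] := r m; exists N => n /zN; rewrite form_evalZ.
have [N zN] := zc (size c); case/eqP: c0; apply/polyP=> i; rewrite coef0.
have [/(zN N (leqnn N))//|] := ltnP i (size c).
exact: nth_default.
Qed.

(** A nonzero relation of least degree [d]. *)
Variables (d : nat) (p : {poly {poly rat}}).
Hypothesis p_neq0 : p != 0.
Hypothesis size_p : (size p <= d.+1)%N.
Hypothesis rel_p : relation d p.
Hypothesis d_min : forall d' q, (d' < d)%N -> (size q <= d'.+1)%N ->
  relation d' q -> q = 0.

Lemma lead_p_neq0 : p`_d != 0.
Proof.
apply/negP => /eqP pd0; have sp : (size p <= d)%N.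
  apply/leq_sizeP => j; rewrite leq_eqVlt => /predU1P[<-//|dj].
  exact: nth_default (leq_trans size_p dj).
case: d size_p rel_p d_min pd0 sp => [|d'] _ rp dm pd0 sp.
  by rewrite size_poly_leq0 (negPf p_neq0) in sp.
by case/eqP: p_neq0; apply: (dm d') => //; apply: relation_lower.
Qed.

Lemma size_pE : size p = d.+1.
Proof.
apply/eqP; rewrite eqn_leq size_p ltnNge; apply: contra lead_p_neq0 => sp.
by rewrite nth_default.
Qed.

Lemma d_gt0 : (0 < d)%N.
Proof.
rewrite lt0n; apply/eqP => d0; move: lead_p_neq0 rel_p; rewrite d0 => p0 rp.
have [N zN] := rp (size p`_0); case/eqP: p0; apply/polyP => i; rewrite coef0.
have [/(zN N (leqnn N))|] := ltnP i (size p`_0); last exact: nth_default.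
by rewrite /form_eval big_ord1 !expr0 !mulr1.
Qed.

(** Power series form a domain, so in a product that is a relation one of the
    factors is a relation already; minimality of the degree makes it constant. *)
Lemma factor_free c q r : c != 0 -> c *: p = q * r ->
  (size q <= 1)%N \/ (size r <= 1)%N.
Proof.
move=> c0 cp; have [|q1] := leqP (size q) 1; first by left.
have [|r1] := leqP (size r) 1; first by right.
have qr0 : q * r != 0 by rewrite -cp scale_poly_eq0 negb_or c0.
have [q0 r0] : q != 0 /\ r != 0 by apply/andP; rewrite -negb_or -mulf_eq0.
have sqr : size (q * r) = d.+1 by rewrite -cp size_scale ?size_pE.
rewrite size_mul // in sqr.
pose d1 := (size q).-1; pose d2 := (size r).-1.
have [dE d1E d2E] : [/\ d = (d1 + d2)%N, size q = d1.+1 & size r = d2.+1].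
  by rewrite /d1 /d2; move: (size q) (size r) q1 r1 sqr => m n q1 r1 sqr; split; lia.
have : relation (d1 + d2) (q * r).
  rewrite -cp -dE => m; have [N zN] := rel_p m; exists N => n /zN zn.
  by rewrite form_evalZ; apply: zordMl.
have [d1d d2d] : (d1 < d)%N /\ (d2 < d)%N by lia.
move=> /relation_mul[||/d_min q00|/d_min r00]; rewrite ?d1E ?d2E //.
  by move: q0; rewrite q00 ?eqxx ?d1E.
by move: r0; rewrite r00 ?eqxx ?d2E.
Qed.

(** A common factor of [p] and its derivative would be a proper factor of [p], so
    the discriminant is nonzero. Up to a factor it is the resultant, which lies
    in the ideal of the two polynomials. *)
Lemma p_separable : exists u v (D : {poly rat}), D != 0 /\ u * p + v * p^`() = D%:P.
Proof.
have dg := d_gt0.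
have sp' : size p^`() = d.
  apply/eqP; rewrite eqn_leq -ltnS -[X in (_ < X)%N]size_pE lt_size_deriv //=.
  rewrite -{1}(ltn_predK dg) ltnNge; apply/negP => /(nth_default 0)/eqP.
  rewrite coef_deriv (ltn_predK dg) -scaler_nat scale_poly_eq0 pnatr_eq0.
  by rewrite (negPf lead_p_neq0) orbF; lia.
have [d1|d1] := leqP d 1.
  have {dg} dE : d = 1%N by lia.
  exists 0, 1, p`_1; split; first by rewrite -dE lead_p_neq0.
  rewrite mul0r add0r mul1r; have : (size p^`() <= 1)%N by rewrite sp' dE.
  by move/size1_polyC => ->; rewrite coef_deriv.
have sp1 : (1 < size p)%N by rewrite size_pE; lia.
have sp'1 : (1 < size p^`())%N by rewrite sp'.
have [uv _ resE] := resultant_in_ideal sp1 sp'1.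
exists uv.1, uv.2, (resultant p p^`()); split=> //.
rewrite resultant_eq0 -leqNgt leqNgt; apply/negP => g1.
have /Pdiv.Idomain.dvdpP[[c q] /= c0 cp] := dvdp_gcdl p p^`().
have [q1|] := factor_free c0 cp; last by rewrite leqNgt g1.
have : (size (gcdp p p^`()) <= size p^`())%N.
  by apply: leq_gcdpr; rewrite -size_poly_gt0; apply: ltnW.
have := size_polyMleq q (gcdp p p^`()); rewrite -cp size_scale // size_pE sp'.
by move: (size (gcdp _ _)) (size q) q1 => k l; lia.
Qed.

(** The functional equation turns [p] into a second form of degree [d] that
    vanishes at (H(z^T), H(z^(T^2))), next to [p] with z replaced by z^T.
    Eliminating the leading coefficient between the two leaves a relation of
    lower degree, hence 0: the two forms are proportional, and primitivity makes
    the factor a polynomial. *)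
Lemma semi_invariance : (exists u : nat -> _, \sum_(i < d.+1) u i * p`_i = 1) ->
  exists c, form_subst d p a 'X^e 1 0 = c *: map_poly (comp_poly 'X^T) p.
Proof.
move=> [u up].
set G := form_subst _ _ _ _ _ _; set F := map_poly _ p.
pose x n := xseq n \Po 'X^T; pose y n := yseq n \Po 'X^T.
have FE n : form_eval d F (x n) (y n) = form_eval d p (xseq n) (yseq n) \Po 'X^T.
  by rewrite (map_form_eval (comp_poly 'X^T)).
have GE n : form_eval d G (x n) (y n) = form_eval d p (xseq n.+1) (yseq n.+1).
  by rewrite form_eval_subst xseqS yseqS mul1r mul0r addr0.
have FG : G`_d *: F = F`_d *: G.
  apply/eqP; rewrite -subr_eq0; set q := _ - _; apply/eqP.
  have sq : (size q <= d)%N.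
    apply/leq_sizeP => j; rewrite leq_eqVlt => /predU1P[<-|dj].
      by rewrite coefB !coefZ mulrC subrr.
    have Gj : G`_j = 0 by apply/nth_default/(leq_trans (size_form_subst _ _ _ _ _ _)).
    have Fj : F`_j = 0.
      by apply/nth_default/(leq_trans (size_poly _ _))/(leq_trans size_p).
    by rewrite coefB !coefZ Gj Fj !mulr0 subrr.
  have qz : zadic_null (fun n => form_eval d.-1 q (x n) (y n)).
    apply: (@zadic_nullKl _ y) => [n|]; first by rewrite coef0_comp // yseq_coef0 oner_eq0.
    have -> : (fun n => y n * form_eval d.-1 q (x n) (y n)) = fun n =>
       G`_d * (form_eval d p (xseq n) (yseq n) \Po 'X^T) +
       (- F`_d) * form_eval d p (xseq n.+1) (yseq n.+1).
      apply/funext=> n; rewrite -form_evalS ?(ltn_predK d_gt0) //.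
      by rewrite form_evalD form_evalN !form_evalZ FE GE mulNr.
    apply: zadic_nullD; apply: zadic_nullM; first by apply: zadic_null_comp => //; exact: rel_p.
    by apply/(@zadic_nullS _ (fun n => form_eval d p (xseq n) (yseq n))).
  (* The inverse of the matrix, multiplied by 'X^e, turns [q] into a form at
     (H(z), H(z^T)). *)
  pose r := form_subst d.-1 q 0 'X^e 1 (- a).
  have r0 : r = 0.
    apply: (@d_min d.-1); [by have := d_gt0; lia|exact: size_form_subst|].
    apply/zadic_nullS => m; have [N zN] := qz m; exists N => n /zN zn.
    rewrite form_eval_subst xseqS yseqS mul0r add0r mul1r.
    have -> : a * (xseq n \Po 'X^T) + 'X^e * (yseq n \Po 'X^T) +
      - a * (xseq n \Po 'X^T) = 'X^e * y n by rewrite /y; ring.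
    by rewrite form_eval_scale; apply: zordMl.
  have : form_eval d.-1 (map_poly polyC r) (a *: 'X + 'X^e%:P) 'X = 0.
    by rewrite r0 rmorph0 form_eval0.
  rewrite map_form_subst form_eval_subst.
  have -> : 0%:P * (a *: 'X + ('X^e)%:P) + ('X^e)%:P * 'X = ('X^e)%:P * 'X
    :> {poly {poly rat}} by rewrite mul0r add0r.
  have -> : 1%:P * (a *: 'X + ('X^e)%:P) + (- a)%:P * 'X = ('X^e)%:P * 1
    :> {poly {poly rat}} by rewrite -mul_polyC polyCN; ring.
  rewrite form_eval_scale form_eval1; last first.
    by rewrite size_map_polyC (ltn_predK d_gt0).
  have nz : ('X^e)%:P ^+ d.-1 != 0 :> {poly {poly rat}}.
    by rewrite expf_neq0 // polyC_eq0 expf_neq0 // polyX_eq0.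
  move/eqP; rewrite mulf_eq0 (negPf nz) /= => /eqP.
  by rewrite -[X in X = 0]/(q \Po 'X) comp_polyXr.
have F_d : F`_d != 0.
  rewrite coef_map /= comp_poly_eq0 ?lead_p_neq0 // size_polyXn; lia.
exists (\sum_(i < d.+1) G`_i * (u i \Po 'X^T)).
have Gd : G`_d = F`_d * \sum_(i < d.+1) G`_i * (u i \Po 'X^T).
  transitivity (G`_d * ((\sum_(i < d.+1) u i * p`_i) \Po 'X^T)).
    by rewrite up comp_polyC mulr1.
  rewrite rmorph_sum /= !mulr_sumr; apply: eq_bigr => i _.
  have FiE : F`_i = p`_i \Po 'X^T by rewrite coef_map.
  have /polyP/(_ i) := FG; rewrite !coefZ FiE => FGi.
  by rewrite rmorphM /= mulrCA FGi; ring.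
apply/polyP => i; have /polyP/(_ i) := FG; rewrite !coefZ Gd => /eqP.
by rewrite -mulrA (inj_eq (mulfI F_d)) => /eqP <-.
Qed.
End Relations.

(** * Singular specializations *)

Definition eval_at (rho : algC) : {rmorphism {poly rat} -> algC} :=
  horner_eval rho \o map_poly ratr.

Lemma eval_atE rho p : eval_at rho p = (map_poly ratr p).[rho]. Proof. by []. Qed.

Lemma eval_at_comp rho T p : eval_at rho (p \Po 'X^T) = eval_at (rho ^+ T) p.
Proof. by rewrite !eval_atE map_comp_poly map_polyXn horner_comp hornerXn. Qed.

Lemma eval_atX rho e : eval_at rho 'X^e = rho ^+ e.
Proof. by rewrite eval_atE map_polyXn hornerXn. Qed.

Lemma eval_at1 p : eval_at 1 p = ratr p.[1].
Proof. by rewrite eval_atE -horner_map rmorph1. Qed.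

Lemma roots_of_rho (n : nat) (rho : algC) : (0 < n)%N -> rho != 0 ->
  exists rs : seq algC, [/\ uniq rs, size rs = n & {in rs, forall r, r ^+ n = rho}].
Proof.
move=> n0 rho0; have [z z_prim] := C_prim_root_exists n0.
pose s := n.-root rho.
have sn : s ^+ n = rho by rewrite rootCK.
have s0 : s != 0 by apply: contraNneq rho0 => s0; rewrite -sn s0 expr0n gtn_eqF.
exists [seq s * z ^+ i | i <- iota 0 n]; split.
- rewrite map_inj_in_uniq ?iota_uniq // => i j.
  rewrite !mem_iota !add0n /= => lti ltj /(mulfI s0)/eqP.
  by rewrite (eq_prim_root_expr z_prim) !modn_small // => /eqP.
- by rewrite size_map size_iota.
move=> r /mapP[i _ ->].
by rewrite exprMn sn exprAC (prim_expr_order z_prim) expr1n mulr1.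
Qed.

Section Singular.
Variables (T : nat) (a : {poly rat}) (e d : nat) (p : {poly {poly rat}}).
Variables (c D : {poly rat}) (u v : {poly {poly rat}}).
Hypothesis T_gt1 : (1 < T)%N.
Hypothesis size_p : (size p <= d.+1)%N.
Hypothesis lead_p : p`_d != 0.
Hypothesis p_inv : form_subst d p a 'X^e 1 0 = c *: map_poly (comp_poly 'X^T) p.
Hypothesis p_sep : u * p + v * p^`() = D%:P.
Hypothesis D_neq0 : D != 0.

Definition form_at rho : {poly algC} := map_poly (eval_at rho) p.

(** The specialized form on the line through (x0, y0) in direction (x1, y1). *)
Definition pencil rho (x0 y0 x1 y1 : algC) : {poly algC} :=
  form_eval d (map_poly polyC (form_at rho)) (x0%:P + x1 *: 'X) (y0%:P + y1 *: 'X).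

(** A multiple zero is described along a line, not by partial derivatives, so
    that linear substitutions act on it directly. The zero form is singular. *)
Definition singular rho := exists x0 y0 x1 y1,
  x0 * y1 - x1 * y0 != 0 /\ zord 2 (pencil rho x0 y0 x1 y1).

Lemma size_form_at rho : (size (form_at rho) <= d.+1)%N.
Proof. exact: leq_trans (size_poly _ _) size_p. Qed.

Lemma pencil_inv rho x0 y0 x1 y1 : 
  pencil rho (eval_at rho a * x0 + rho ^+ e * y0) x0 (eval_at rho a * x1 + rho ^+ e * y1) x1
  = eval_at rho c *: pencil (rho ^+ T) x0 y0 x1 y1.
Proof.
have := congr1 (map_poly polyC \o map_poly (eval_at rho)) p_inv.
rewrite [LHS]/= [RHS]/= !map_form_subst eval_atX !rmorph0 !rmorph1.
move=> /(congr1 (fun q => form_eval d q (x0%:P + x1 *: 'X) (y0%:P + y1 *: 'X))).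
rewrite form_eval_subst mul1r mul0r addr0 => E.
rewrite /pencil; transitivity (form_eval d (map_poly polyC (map_poly (eval_at rho) p))
  ((eval_at rho a)%:P * (x0%:P + x1 *: 'X) + (rho ^+ e)%:P * (y0%:P + y1 *: 'X))
  (x0%:P + x1 *: 'X)).
  congr form_eval; rewrite !(rmorphD, rmorphM) /= -!mul_polyC !rmorphD !rmorphM /=; ring.
rewrite E !map_polyZ form_evalZ mul_polyC; congr (_ *: form_eval _ _ _ _).
rewrite /form_at -!map_poly_comp; apply: eq_map_poly => q; congr _%:P.
exact: eval_at_comp.
Qed.

Lemma horner_pencil rho x0 y0 x1 y1 t : (pencil rho x0 y0 x1 y1).[t] =
  form_eval d (form_at rho) (x0 + x1 * t) (y0 + y1 * t).
Proof. by rewrite horner_form_eval !hornerE. Qed.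

(** The matrix of the functional equation at [rho] is invertible and, by
    semi-invariance, carries a line along which the form at [rho ^+ T] has a
    double zero to one along which the form at [rho] has one. *)
Lemma singular_preimage rho : rho != 0 -> singular (rho ^+ T) -> singular rho.
Proof.
move=> rho0 [x0 [y0 [x1 [y1 [det zp]]]]].
exists (eval_at rho a * x0 + rho ^+ e * y0), x0, (eval_at rho a * x1 + rho ^+ e * y1), x1.
split; last by rewrite pencil_inv -mul_polyC; apply: zordMl.
have -> : (eval_at rho a * x0 + rho ^+ e * y0) * x1 -
  (eval_at rho a * x1 + rho ^+ e * y1) * x0 = - rho ^+ e * (x0 * y1 - x1 * y0) by ring.
by rewrite mulf_neq0 // oppr_eq0 expf_neq0.
Qed.

(** A double zero of the form at [rho] is either the point at infinity, where
    the leading coefficient vanishes, or a common root of the polynomial and of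
    its derivative, where [D] does. *)
Lemma singular_finite rho : (0 < d)%N -> singular rho -> eval_at rho (D * p`_d) = 0.
Proof.
move=> d0 [x0 [y0 [x1 [y1 [det zp]]]]].
have c0 : form_eval d (form_at rho) x0 y0 = 0.
  by rewrite -(zp 0%N isT) -horner_coef0 horner_pencil !mulr0 !addr0.
rewrite rmorphM; apply/eqP; rewrite mulf_eq0; apply/orP.
have [y00|y00] := eqVneq y0 0.
  right; move: c0; rewrite /form_eval big_ord_recr /= subnn big1 => [|i _].
    rewrite add0r expr0 mulr1 coef_map /= => /eqP; rewrite mulf_eq0 => /orP[//|].
    rewrite expf_eq0 d0 /= => /eqP x00.
    by rewrite x00 y00 mul0r mulr0 subrr eqxx in det.
  by rewrite y00 expr0n subn_eq0 leqNgt ltn_ord mulr0.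
left; pose r := x0 / y0; have x0E : x0 = r * y0 by rewrite divfK.
have root_r : root (form_at rho) r.
  move: c0; rewrite x0E form_eval_line ?size_form_at // => /eqP.
  by rewrite mulf_eq0 expf_eq0 (negPf y00) andbF.
have /factor_theorem[q qE] := root_r.
have sq : (size q <= d.-1.+1)%N.
  have := size_form_at rho; rewrite qE; have [->|q0] := eqVneq q 0; first by rewrite size_poly0.
  by rewrite size_Mmonic ?monicXsubC // size_XsubC addn2 /= ltnS prednK.
have q0 : q.[r] = 0.
  have kappa : x1 - r * y1 != 0.
    apply: contraNneq det => k0; rewrite x0E.
    have -> : r * y0 * y1 - x1 * y0 = - y0 * (x1 - r * y1) by ring.
    by rewrite k0 mulr0.
  have : pencil rho x0 y0 x1 y1 = ((x1 - r * y1) *: 'X) *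
    form_eval d.-1 (map_poly polyC q) (x0%:P + x1 *: 'X) (y0%:P + y1 *: 'X).
    rewrite /pencil qE rmorphM /=.
    have -> : form_eval d = form_eval (d.-1 + 1) :> (_ -> _ -> _ -> {poly algC}).
      by rewrite addn1 prednK.
    rewrite form_evalM ?size_map_polyC ?size_XsubC // mulrC; congr (_ * _).
    rewrite rmorphB /= map_polyX map_polyC /=.
    have -> : 'X - r%:P%:P = 1 *: 'X + (- r%:P)%:P :> {poly {poly algC}}.
      by rewrite scale1r polyCN.
    rewrite form_eval_linear.
    rewrite mul1r x0E -!mul_polyC !rmorphB !rmorphM /=; ring.
  move=> /(congr1 (fun w : {poly algC} => w`_1)); rewrite zp // -scalerAl coefZ coefXM /=.
  move=> /esym/eqP; rewrite mulf_eq0 (negPf kappa) /= -horner_coef0.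
  rewrite horner_form_eval !hornerE ?mulr0 ?addr0 x0E form_eval_line // mulf_eq0 expf_eq0.
  by rewrite (negPf y00) andbF => /eqP.
have /eqP pr := root_r.
have dpr : (form_at rho)^`().[r] = 0.
  by rewrite qE derivM derivXsubC mulr1 !hornerE q0 subrr mulr0 add0r.
have := congr1 (fun w => (map_poly (eval_at rho) w).[r]) p_sep.
rewrite /= rmorphD !rmorphM /= map_polyC hornerC hornerD !hornerM -deriv_map.
by rewrite -/(form_at rho) pr dpr !mulr0 addr0 => E; apply/eqP/(etrans (esym E)).
Qed.

(** All [T ^ n]-th roots of a nonzero singular point are singular, and for large
    [n] there are more of them than a nonzero polynomial has roots. *)
Lemma not_singular rho : (0 < d)%N -> rho != 0 -> ~ singular rho.
Proof.
move=> d0 rho0 s_rho.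
pose Q := map_poly (ratr : rat -> algC) (D * p`_d).
have Q0 : Q != 0 by rewrite map_poly_eq0 mulf_neq0.
pose n := size Q.
have back r : r ^+ (T ^ n) = rho -> singular r.
  elim: {Q0} n r => [|n IH] r; first by rewrite expn0 expr1 => ->.
  rewrite expnS exprM => rE; apply: singular_preimage; last exact: IH.
  apply: contraNneq rho0 => r0; rewrite -rE r0 -exprM expr0n.
  by rewrite -expnS expn_eq0; case: T T_gt1.
have Tn : (0 < T ^ n)%N by rewrite expn_gt0; case: T T_gt1.
have [rs [urs srs rsE]] := roots_of_rho Tn rho0.
have : (size rs < size Q)%N.
  apply: max_poly_roots => //; apply/allP => r /rsE/back/singular_finite.
  by rewrite eval_atE => /(_ d0) /eqP.
by rewrite srs -/n ltnNge ltnW // ltn_expl.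
Qed.
End Singular.

(** * Specialization at 1 *)

Lemma coef_comp_scaleX (A : comNzRingType) (q : {poly A}) (c : A) i :
  (q \Po (c *: 'X))`_i = c ^+ i * q`_i.
Proof.
rewrite comp_polyE coef_sum.
under eq_bigr => j _ do rewrite exprZn !coefZ coefXn.
have [iq|iq] := ltnP i (size q); last first.
  rewrite nth_default // mulr0 big1 // => j _.
  by rewrite gtn_eqF ?mulr0 // (leq_trans _ iq).
rewrite (bigD1 (Ordinal iq)) //= eqxx mulr1 big1 ?addr0 1?mulrC // => j.
by rewrite -val_eqE /= eq_sym => /negPf ->; rewrite !mulr0.
Qed.

Lemma pencil_scale d p rho x0 y0 x1 y1 (k l : algC) : k != 0 ->
  forall i, (pencil d p rho (k * x0) (k * y0) (l * x1) (l * y1))`_i =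
    k ^+ d * (l / k) ^+ i * (pencil d p rho x0 y0 x1 y1)`_i.
Proof.
move=> k0 i; pose r : {poly algC} := (l / k) *: 'X.
have lin z0 z1 : (k * z0)%:P + (l * z1) *: 'X =
    k%:P * ((z0%:P + z1 *: 'X) \Po r).
  rewrite comp_polyD comp_polyC comp_polyZ comp_polyX /r mulrDr -polyCM.
  by rewrite mul_polyC !scalerA; congr (_ + _ *: _); field.
have -> : pencil d p rho (k * x0) (k * y0) (l * x1) (l * y1) =
    k ^+ d *: (pencil d p rho x0 y0 x1 y1 \Po r).
  rewrite /pencil !lin form_eval_scale -rmorphXn mul_polyC (map_form_eval (comp_poly r)).
  rewrite -[in RHS]map_poly_comp; congr (_ *: form_eval _ _ _ _).
  by apply: eq_map_poly => z; rewrite /= comp_polyC.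
by rewrite coefZ coef_comp_scaleX mulrA.
Qed.

Section EigenPencil.
Variables (T : nat) (a : {poly rat}) (e d : nat) (p : {poly {poly rat}}).
Variables (c : {poly rat}) (s : algC).
Hypothesis p_inv : form_subst d p a 'X^e 1 0 = c *: map_poly (comp_poly 'X^T) p.
Hypothesis a1 : eval_at 1 a = s.
Hypothesis p1 : ~ singular d p 1.

(** On the pencil spanned by two eigenvectors of the matrix at 1, invariance
    leaves room for a single monomial, whose exponent is at most 1 by
    nonsingularity. *)
Lemma eigen_pencil (x y : algC) :
  x ^+ 2 = s * x + 1 -> y ^+ 2 = s * y + 1 -> x != 0 -> x != y ->
  injective (fun i => (y / x) ^+ i) ->
  exists l i, [/\ l != 0, (i <= 1)%N & pencil d p 1 x 1 y 1 = l *: 'X^i].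
Proof.
move=> xE yE x0 xy inj; set L := pencil _ _ _ _ _ _ _.
have coefL i : x ^+ d * (y / x) ^+ i * L`_i = eval_at 1 c * L`_i.
  rewrite -pencil_scale // mulr1 -[in RHS]coefZ mulr1.
  have := pencil_inv p_inv 1 x 1 y 1; rewrite a1 expr1n -/L !expr1n !mulr1 => <-.
  by rewrite -xE -yE !expr2.
have [i i1 Li] : exists2 i, (i <= 1)%N & L`_i != 0.
  apply: contrapT => /forall2NP nL; apply: p1; exists x, 1, y, 1; split.
    by rewrite mulr1 mulr1 subr_eq0.
  by move=> i i1; have [|/negP/negPn/eqP] := nL i.
exists L`_i, i; split=> //; apply/polyP => j; rewrite coefZ coefXn.
have [->|ji] := eqVneq j i; first by rewrite mulr1.
rewrite mulr0; apply: contraNeq ji => Lj; apply/eqP/inj.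
have xd : x ^+ d != 0 by rewrite expf_neq0.
have := coefL i; have := coefL j.
by move=> /(mulIf Lj) <- /(mulIf Li)/(mulfI xd).
Qed.

(** Exchanging the two eigenvectors exchanges the exponents [i] and [d - i] of
    the monomial, so both are at most 1. In degree 1 one of the eigenvectors is
    the zero of the form. *)
Lemma eigen_degree (x y : algC) :
  x ^+ 2 = s * x + 1 -> y ^+ 2 = s * y + 1 -> x != 0 -> y != 0 -> x != y ->
  injective (fun i => (y / x) ^+ i) -> injective (fun i => (x / y) ^+ i) ->
  (d <= 2)%N /\ (d = 1%N -> exists z, [/\ z ^+ 2 = s * z + 1,
    (form_at p 1)`_1 * z + (form_at p 1)`_0 = 0 &
    (form_at p 1)`_1 != 0]).
Proof.
move=> xE yE x0 y0 xy inj inj'.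
have [l [i [l0 i1 L]]] := eigen_pencil xE yE x0 xy inj.
have yx : y != x by rewrite eq_sym.
have [l' [j [l'0 j1 L']]] := eigen_pencil yE xE y0 yx inj'.
have rev t : t != 0 -> l' * t ^+ j = t ^+ d * (l * t^-1 ^+ i).
  move=> t0; transitivity (l' *: 'X^j).[t]; first by rewrite !hornerE.
  rewrite -L' horner_pencil.
  transitivity (t ^+ d * (pencil d p 1 x 1 y 1).[t^-1]); last by rewrite L !hornerE.
  by rewrite horner_pencil -form_eval_scale; congr form_eval; field.
(* Evaluation at 1 and at 2 compares the coefficients and the exponents. *)
have ll : l' = l by have := rev 1 (oner_neq0 _); rewrite invr1 !expr1n mul1r !mulr1.
have dE : d = (i + j)%N.
  have two0 : 2%:R != 0 :> algC by rewrite pnatr_eq0.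
  have := rev 2%:R two0; rewrite ll exprVn mulrCA => /(mulfI l0).
  move=> /(congr1 (fun z => z * 2%:R ^+ i)); rewrite mulfVK ?expf_neq0 //.
  rewrite -exprD -!natrX => /eqP; rewrite eqr_nat eqn_exp2l // => /eqP <-.
  by rewrite addnC.
split; first by rewrite dE; lia.
move=> d1; have [w [wE w0]] : exists w, w ^+ 2 = s * w + 1 /\
    form_eval d (form_at p 1) w 1 = 0.
  have [i0|iE] : i = 0%N \/ i = 1%N by lia.
    exists y; split=> //; have jE : j = 1%N by lia.
    have := horner_pencil d p 1 y 1 x 1 0.
    by rewrite L' jE !mulr0 !addr0 => <-; rewrite !hornerE.
  exists x; split=> //; have := horner_pencil d p 1 x 1 y 1 0.
  by rewrite L iE !mulr0 !addr0 => <-; rewrite !hornerE.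
have wE' : (form_at p 1)`_1 * w + (form_at p 1)`_0 = 0.
  by move: w0; rewrite d1 /form_eval big_ord_recl big_ord1 /= expr0 !expr1n expr1 !mulr1 addrC.
exists w; split=> //; apply/eqP => p10; move: wE'; rewrite p10 mul0r add0r => p00.
have : (l *: 'X^i).[1] = 0.
  by rewrite -L horner_pencil d1 /form_eval big_ord_recl big_ord1 /= p00 p10 !mul0r addr0.
by rewrite !hornerE expr1n mulr1 => /eqP; rewrite (negPf l0).
Qed.
End EigenPencil.

(** The eigenvalues have product -1 and one of them exceeds 1, so their ratio is
    not a root of unity. *)
Lemma eigenvalues (s : nat) : (0 < s)%N -> exists x y : algC,
  [/\ x ^+ 2 = s%:R * x + 1, y ^+ 2 = s%:R * y + 1, x != 0, y != 0 & x != y] /\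
  (injective (fun i => (y / x) ^+ i) /\ injective (fun i => (x / y) ^+ i)).
Proof.
move=> s0; pose r : algC := sqrtC (s%:R ^+ 2 + 4%:R).
have rE : r ^+ 2 = s%:R ^+ 2 + 4%:R by rewrite sqrtCK.
have r0 : 0 < r by rewrite sqrtC_gt0 ltr_wpDl // exprn_ge0.
have r2 : 2%:R <= r.
  rewrite -(@ler_pXn2r _ 2) ?nnegrE ?(ltW r0) // rE.
  have -> : s%:R ^+ 2 + 4%:R = (s ^ 2 + 4)%:R :> algC by rewrite natrD natrX.
  have -> : 2%:R ^+ 2 = 4%:R :> algC by rewrite -natrX.
  by rewrite ler_nat leq_addl.
pose x := (s%:R + r) / 2%:R; pose y := (s%:R - r) / 2%:R.
have x1 : 1 < x.
  rewrite ltr_pdivlMr // mul1r (@lt_le_trans _ _ (1 + 2%:R)) //.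
    by rewrite ltrDr.
  by rewrite lerD // ler1n.
have xy : x * y = -1.
  transitivity ((s%:R ^+ 2 - r ^+ 2) / 4%:R); first by rewrite /x /y; field.
  by rewrite rE; field.
have xE : x ^+ 2 = s%:R * x + 1.
  apply/eqP; rewrite -subr_eq0; apply/eqP.
  transitivity ((r ^+ 2 - (s%:R ^+ 2 + 4%:R)) / 4%:R); last by rewrite rE subrr mul0r.
  by rewrite /x; field.
have yE : y ^+ 2 = s%:R * y + 1.
  apply/eqP; rewrite -subr_eq0; apply/eqP.
  transitivity ((r ^+ 2 - (s%:R ^+ 2 + 4%:R)) / 4%:R); last by rewrite rE subrr mul0r.
  by rewrite /y; field.
have x0 : x != 0 by rewrite gt_eqF // (lt_trans ltr01).
have y0 : y != 0 by apply: contra_eq_neq xy => ->; rewrite mulr0 eq_sym oppr_eq0 oner_eq0.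
have nx : `|x| = x by rewrite ger0_norm // ltW // (lt_trans ltr01).
have ny : `|y| = x^-1.
  by apply: (mulfI x0); rewrite divff // -{1}nx -normrM xy normrN1.
have q1 : `|y / x| < 1.
  have x_gt0 : 0 < x := lt_trans ltr01 x1.
  by rewrite normf_div nx ny ltr_pdivrMr // mul1r (lt_trans _ x1) // invf_lt1.
have q0 : 0 < `|y / x| by rewrite normr_gt0 mulf_neq0 ?invr_eq0.
have inj : injective (fun i => (y / x) ^+ i).
  move=> i j /(congr1 (fun z => `|z|)); rewrite !normrX.
  by apply: ieexprIn; rewrite // lt_eqF.
exists x, y; split; first split=> //.
  apply: contraTneq q1 => <-; by rewrite divff // normr1 ltxx.
split=> // i j /(congr1 (fun z => z^-1)); rewrite -!exprVn invf_div; exact: inj.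
Qed.

(** * Transcendence of the ratio as a function *)

Lemma primitive_poly (F : fieldType) (p : {poly {poly F}}) : p != 0 ->
  exists (c : {poly F}) (q : {poly {poly F}}) (u : nat -> {poly F}),
    [/\ c != 0, p = c *: q, size q = size p &
    \sum_(i < size q) u i * q`_i = 1].
Proof.
move=> p0; have [|c [s [u [c0 ss sE us]]]] := @primitive_part _ (polyseq p).
  apply/hasP; exists (lead_coef p); last by rewrite lead_coef_eq0.
  by rewrite lead_coefE mem_nth // ltn_predL size_poly_gt0.
have coefs i : p`_i = c * s`_i.
  rewrite sE; have [si|si] := ltnP i (size s); first by rewrite (nth_map 0).
  by rewrite !nth_default ?mulr0 ?size_map.
have pE : p = c *: Poly s by apply/polyP => i; rewrite coefZ coef_Poly.
have sq : size (Poly s) = size p by rewrite pE size_scale.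
exists c, (Poly s), u; split=> //; rewrite sq -ss -us.
by apply: eq_bigr => i _; rewrite coef_Poly.
Qed.

(** After removing the power of the variable no complex root is left, so the
    cofactor is constant. *)
Lemma rootfree_monomial (D : {poly rat}) :
  (forall rho : algC, rho != 0 -> eval_at rho D != 0) ->
  exists g m, g != 0 /\ D = g *: 'X^m.
Proof.
move=> nr; have D0 : D != 0.
  by apply: contraTneq (nr 1 (oner_neq0 _)) => ->; rewrite rmorph0 eqxx.
have [m [q /=]] := multiplicity_XsubC D 0; rewrite D0 /= subr0 => q0 DE.
suff /eqP sq : size q == 1%N.
  have /size_poly1P[g g0 qg] := introT eqP sq.
  by exists g, m; split=> //; rewrite DE qg mul_polyC.
rewrite -(size_map_poly (ratr : {rmorphism rat -> algC})).
apply: contraT => /closed_rootP[r rq].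
have r0 : r = 0.
  apply/eqP; apply: contraT => r0; have := nr r r0.
  by rewrite DE rmorphM mulf_eq0 [eval_at r q]eval_atE (eqP rq) eqxx.
by move: q0; rewrite -(fmorph_root (ratr : {rmorphism rat -> algC})) rmorph0 -r0 rq.
Qed.

(** The double zero is the double root of the quadratic polynomial. *)
Lemma singular_quadratic (p : {poly {poly rat}}) rho :
  eval_at rho (p`_1 ^+ 2 - 4%:R * p`_0 * p`_2) = 0 -> singular 2 p rho.
Proof.
rewrite rmorphB rmorphXn !rmorphM rmorph_nat.
rewrite -[eval_at rho p`_1]coef_map -[eval_at rho p`_0]coef_map -[eval_at rho p`_2]coef_map.
rewrite -/(form_at p rho); set P0 := _`_0; set P1 := _`_1; set P2 := _`_2 => disc.
have pencilE x0 y0 x1 y1 : pencil 2 p rho x0 y0 x1 y1 =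
    P0%:P * (y0%:P + y1 *: 'X) ^+ 2 +
    P1%:P * (x0%:P + x1 *: 'X) * (y0%:P + y1 *: 'X) +
    P2%:P * (x0%:P + x1 *: 'X) ^+ 2.
  have cP i : (map_poly polyC (form_at p rho))`_i = ((form_at p rho)`_i)%:P.
    exact: coef_map.
  by rewrite /pencil form_eval_quadratic !cP.
have zord2 (z : algC) : zord 2 (z *: ('X^2)).
  by move=> i i2; rewrite coefZ coefXn ltn_eqF // mulr0.
have [P20|P20] := eqVneq P2 0.
  have P10 : P1 = 0.
    by apply/eqP; rewrite -sqrf_eq0; move: disc; rewrite P20 mulr0 subr0 => ->.
  exists 1, 0, 0, 1; split; first by rewrite mulr1 mul0r subr0 oner_eq0.
  rewrite pencilE P10 P20 !polyC0 !mul0r !addr0 add0r scale1r mul_polyC.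
  exact: zord2.
exists (- (P1 / (2%:R * P2))), 1, 1, 0; split.
  by rewrite mulr0 mulr1 sub0r oppr_eq0 oner_eq0.
have -> : pencil 2 p rho (- (P1 / (2%:R * P2))) 1 1 0 = P2 *: 'X^2.
  rewrite pencilE scale0r scale1r addr0 mulr1 expr1n mulr1 -mul_polyC.
  set b := P1 / _.
  have P1E : P1 = 2%:R * P2 * b by rewrite /b; field.
  have P0E : P0 = P2 * b ^+ 2.
    apply: (mulfI (_ : 4%:R * P2 != 0)); first by rewrite mulf_neq0 // pnatr_eq0.
    transitivity (4%:R * P0 * P2); first by ring.
    by rewrite -(addr0 (_ * P2)) -disc P1E; ring.
  rewrite P0E P1E !(rmorphN, rmorphM, rmorphXn, rmorph_nat) /=; ring.
exact: zord2.
Qed.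

(** Squaring doubles the order of vanishing and squares the leading coefficient. *)
Lemma square_leading (F : fieldType) (u : {poly F}) m (g : F) :
  g != 0 -> zord m (u ^+ 2) -> (u ^+ 2)`_m = g ->
  exists j k, m = (2 * j)%N /\ g = k ^+ 2.
Proof.
move=> g0 zu ug.
have exi : exists i, u`_i != 0.
  apply: contrapT => nu; case/eqP: g0; rewrite -ug.
  suff -> : u = 0 by rewrite expr0n coef0.
  by apply/polyP => i; rewrite coef0; apply/eqP/negPn/negP => ui; apply: nu; exists i.
have [j uj jmin] := ex_minnP exi.
have zj : zord j u.
  by move=> i ij; apply: contraTeq ij => /jmin; rewrite -leqNgt.
have zjj : zord (j + j) (u ^+ 2) by rewrite expr2; apply: zordM.
have cjj : (u ^+ 2)`_(j + j) = u`_j ^+ 2 by rewrite !expr2 coef_zordM.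
exists j, u`_j; have mj : m = (j + j)%N.
  apply/eqP; rewrite eqn_leq; apply/andP; split; rewrite leqNgt; apply/negP => lt.
    by have := zu _ lt; rewrite cjj => /eqP; rewrite sqrf_eq0 (negPf uj).
  by case/eqP: g0; rewrite -ug zjj.
by rewrite mul2n -addnn -cjj -mj.
Qed.

Section Transcendence.
Variables (T : nat) (a : {poly rat}) (e s : nat) (h : nat -> {poly rat}).
Hypothesis T_gt1 : (1 < T)%N.
Hypothesis h_rec : forall n,
  h n.+2 = a * (h n.+1 \Po 'X^T) + 'X^e * ((h n \Po 'X^T) \Po 'X^T).
Hypothesis h_coef0 : forall n, (h n.+1)`_0 = 1.
Hypothesis h_cauchy : zadic_cauchy h.
Hypothesis s_gt0 : (0 < s)%N.
Hypothesis a1 : a.[1] = s%:R.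

(** Take a nonzero relation of least degree. It is semi-invariant and
    nonsingular at 1, so its degree is at most 2 by the eigenvalues of the
    matrix at 1. In degree 1 such an eigenvalue would be rational. In degree 2
    the discriminant has no nonzero root, so it is a monomial; as it is also the
    square of a power series to leading order, it is a square, and the form
    splits into linear factors, against minimality. *)
Theorem no_relation d (p : {poly {poly rat}}) :
  (size p <= d.+1)%N -> relation T h d p -> p = 0.
Proof.
have T0 : (0 < T)%N by exact: ltnW.
elim/ltn_ind: d p => d IH p sp rp; apply/eqP/negPn/negP => p0.
have [c [q [u [c0 pE sqp uq]]]] : exists (c : {poly rat}) (q : {poly {poly rat}})
    (u : nat -> {poly rat}), [/\ c != 0, p = c *: q, size q = size p &
    \sum_(i < size q) u i * q`_i = 1] := primitive_poly p0.
have q0 : q != 0 by apply: contraNneq p0 => q0; rewrite pE q0 scaler0.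
have sq : (size q <= d.+1)%N by rewrite sqp.
have rq : relation T h d q.
  by apply: (relation_cancel T0 h_cauchy c0); rewrite -pE.
have qmin d' (r : {poly {poly rat}}) :
    (d' < d)%N -> (size r <= d'.+1)%N -> relation T h d' r -> r = 0.
  by move=> dd' sr; apply: IH.
have lead_q := lead_p_neq0 T0 h_coef0 q0 sq rq qmin.
have size_q := size_pE T0 h_coef0 q0 sq rq qmin.
have d0 := d_gt0 T0 h_coef0 q0 sq rq qmin.
have [k q_inv] : exists k, form_subst d q a 'X^e 1 0 = k *: map_poly (comp_poly 'X^T) q.
  apply: (semi_invariance T0 h_rec h_coef0 q0 sq rq qmin).
  by exists u; rewrite -size_q.
have [u' [v' [D [D0 q_sep]]]] := p_separable T0 h_coef0 h_cauchy q0 sq rq qmin.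
have nsing rho : rho != 0 -> ~ singular d q rho.
  by apply: (not_singular T_gt1 sq lead_q q_inv q_sep D0 d0).
have a1C : eval_at 1 a = s%:R :> algC by rewrite eval_at1 a1 rmorph_nat.
have nsing1 := nsing 1 (oner_neq0 _).
have [x [y [[xE yE x0 y0 xy] [inj inj']]]] := eigenvalues s_gt0.
have [d2 dd1] := eigen_degree q_inv a1C nsing1 xE yE x0 y0 xy inj inj'.
(* [z] below is an eigenvalue; the form of degree 1 has rational coefficients. *)
have [d1|d2'] : d = 1%N \/ d = 2%N by lia.
  have [z [zE zq q10]] := dd1 d1.
  have qev i : (form_at q 1)`_i = ratr (q`_i).[1].
    by rewrite coef_map [LHS]eval_at1.
  rewrite !qev in zq q10.
  have zr : z = ratr (- ((q`_0).[1] / (q`_1).[1])).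
    rewrite rmorphN fmorph_div /=; apply: (mulfI q10).
    by rewrite mulrN mulrCA divff // mulr1; apply/eqP; rewrite -addr_eq0 zq.
  have := unit_quadratic_irrational (- ((q`_0).[1] / (q`_1).[1])) s_gt0.
  rewrite -(inj_eq (fmorph_inj (ratr : {rmorphism rat -> algC}))) /=.
  by rewrite rmorphXn rmorphD rmorphM rmorph_nat rmorph1 /= -zr zE eqxx.
rewrite d2' in sq rq size_q lead_q nsing.
pose Delta := q`_1 ^+ 2 - 4%:R * q`_0 * q`_2.
have [g [m [g0 DE]]] : exists g m, g != 0 /\ Delta = g *: 'X^m.
  apply: rootfree_monomial => rho rho0; apply/eqP => ev0.
  exact: nsing rho0 (singular_quadratic ev0).
(* Completing the square. *)
have complete w1 w2 : (2%:R * q`_2 * w1 + q`_1 * w2) ^+ 2 =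
    Delta * w2 ^+ 2 + 4%:R * q`_2 * form_eval 2 q w1 w2.
  by rewrite form_eval_quadratic /Delta; ring.
have [N zN] := rq m.+1; have {zN} zN := zN N (leqnn N).
pose w1 := xseq h N; pose w2 := yseq T h N.
have wE : (2%:R * q`_2 * w1 + q`_1 * w2) ^+ 2 - (g *: w2 ^+ 2) * 'X^m =
    4%:R * q`_2 * form_eval 2 q w1 w2.
  by rewrite complete DE -!scalerAl [w2 ^+ 2 * _]mulrC; ring.
have w20 : w2`_0 = 1 by apply: yseq_coef0.
have zw : zord m.+1 (4%:R * q`_2 * form_eval 2 q w1 w2) by apply: zordMl.
set w := 2%:R * _ * _ + _ in wE.
have w2E i : (i <= m)%N -> (w ^+ 2)`_i = ((g *: w2 ^+ 2) * 'X^m)`_i.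
  by move=> im; apply/eqP; rewrite -subr_eq0 -coefB wE zw.
have [|||j [kappa [mj gk]]] := @square_leading _ w m g => //.
- by move=> i im; rewrite w2E ?(ltnW im) // coefMXn im.
- by rewrite w2E // coefMXn ltnn subnn coefZ -horner_coef0 horner_exp horner_coef0 w20 expr1n mulr1.
have c4 : 4%:R * q`_2 != 0 by rewrite mulf_neq0 // -polyC_natr polyC_eq0 pnatr_eq0.
pose l := kappa *: 'X^j.
have fact : (4%:R * q`_2) *: q =
    ((2%:R * q`_2) *: 'X + (q`_1 - l)%:P) * ((2%:R * q`_2) *: 'X + (q`_1 + l)%:P).
  have lE : l ^+ 2 = Delta by rewrite DE gk mj exprZn -exprM mulnC.
  have qE : q = (q`_0)%:P + (q`_1)%:P * 'X + (q`_2)%:P * 'X^2.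
    rewrite -[LHS]coefK size_q poly_def !big_ord_recl big_ord0 addr0 addrA.
    by rewrite -!mul_polyC expr0 expr1 mulr1.
  transitivity (((2%:R * q`_2) *: 'X + (q`_1)%:P) ^+ 2 - (l ^+ 2)%:P); last first.
    rewrite polyCB polyCD rmorphXn /=; set A := (2%:R * _) *: _.
    by move: (q`_1)%:P l%:P A => B L A; ring.
  rewrite lE [X in _ *: X = _]qE /Delta -!mul_polyC.
  rewrite !(rmorphB, rmorphM, rmorph_nat, rmorphXn) /=.
  by move: (q`_0)%:P (q`_1)%:P (q`_2)%:P => A B C; ring.
have size2 (b : {poly rat}) :
    size ((2%:R * q`_2) *: 'X + b%:P : {poly {poly rat}}) = 2%N.
  have c2 : 2%:R * q`_2 != 0 by rewrite mulf_neq0 // -polyC_natr polyC_eq0 pnatr_eq0.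
  have sX : size ((2%:R * q`_2) *: 'X : {poly {poly rat}}) = 2%N.
    by rewrite size_scale ?size_polyX.
  by rewrite size_polyDl sX // ltnS size_polyC_leq1.
have sq' : (size q <= d.+1)%N by rewrite d2'.
have rq' : relation T h d q by rewrite d2'.
by have [] := factor_free T0 h_coef0 h_cauchy q0 sq' rq' qmin c4 fact; rewrite size2.
Qed.
End Transcendence.

(** * Stern polynomials *)

Section Stern.
Variable t : nat.

Lemma stern_double n : stern t n.*2 = 'X * (stern t n \Po 'X^t).
Proof.
case: n => [|n]; first by rewrite stern0 comp_poly0 mulr0.
by rewrite -mul2n stern_even.
Qed.

Lemma stern_doubleS n :
  stern t n.*2.+1 = (stern t n.+1 \Po 'X^t) + (stern t n \Po 'X^t).
Proof.
case: n => [|n]; first by rewrite stern0 stern1 comp_poly0 addr0 comp_polyC.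
by have := @stern_odd t n.+1 isT; rewrite mul2n !addn1.
Qed.

(** The recurrences for even and odd indices, iterated [k] times. *)
Lemma stern_block k n j : (j <= 2 ^ k)%N ->
  stern t (2 ^ k * n + j) =
    stern t (2 ^ k - j) * (stern t n \Po 'X^(t ^ k)) +
    stern t j * (stern t n.+1 \Po 'X^(t ^ k)).
Proof.
have compXX m l (p : {poly int}) : (p \Po 'X^m) \Po 'X^l = p \Po 'X^(l * m).
  by rewrite -comp_polyA rmorphXn /= comp_polyX -exprM.
elim: k j => [|k IH] j.
  rewrite expn0 expn0 expr1 !comp_polyXr mul1n; case: j => [|[|//]] _.
    by rewrite addn0 subn0 stern1 stern0 mul1r mul0r addr0.
  by rewrite addn1 subnn stern1 stern0 mul1r mul0r add0r.
have compE m : stern t m \Po 'X^(t ^ k.+1) = (stern t m \Po 'X^(t ^ k)) \Po 'X^t.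
  by rewrite compXX expnS.
move=> jk; have [i jE] : exists i, j = i.*2 \/ j = i.*2.+1.
  by exists j./2; have := odd_double_half j; case: odd => /= jE; [right|left]; lia.
rewrite !compE; have eE m : (2 ^ k.+1 * n + m.*2 = (2 ^ k * n + m).*2)%N.
  by rewrite expnS -mulnA; lia.
case: jE => jE; rewrite jE in jk *.
  have ik : (i <= 2 ^ k)%N by rewrite expnS in jk; lia.
  have -> : (2 ^ k.+1 - i.*2 = (2 ^ k - i).*2)%N by rewrite expnS; lia.
  by rewrite eE !stern_double IH // rmorphD !rmorphM /=; ring.
have ik : (i < 2 ^ k)%N by rewrite expnS in jk; lia.
have -> : (2 ^ k.+1 * n + i.*2.+1 = (2 ^ k * n + i).*2.+1)%N by rewrite addnS eE.
have -> : (2 ^ k.+1 - i.*2.+1 = (2 ^ k - i.+1).*2.+1)%N by rewrite expnS; lia.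
rewrite !stern_doubleS -addnS !IH ?(ltnW ik) //.
have -> : (2 ^ k - i.+1).+1 = (2 ^ k - i)%N by lia.
by rewrite !rmorphD !rmorphM /=; ring.
Qed.

Lemma stern_pow2_exp k : exists m, (0 < k -> 0 < m)%N /\ stern t (2 ^ k) = 'X^m.
Proof.
elim: k => [|k [m [_ IH]]]; first by exists 0%N; rewrite expn0 stern1.
exists (t * m).+1; rewrite expnS mul2n stern_double IH; split=> //.
by rewrite rmorphXn /= comp_polyX -exprM exprS.
Qed.

Hypothesis t_gt1 : (2 <= t)%N.

(** Two consecutive Stern polynomials have disjoint supports: one of them has an
    even index and exponents congruent to 1 modulo [t], the other has exponents
    divisible by [t]. *)
Lemma stern_coef n i :
  [/\ 0 <= (stern t n)`_i, 0 <= (stern t n.+1)`_i &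
      (stern t n)`_i + (stern t n.+1)`_i <= 1].
Proof.
have t0 : (0 < t)%N by lia.
elim/ltn_ind: n i => -[|n] IH i.
  by rewrite stern0 stern1 coef0 coef1 add0r; split=> //; case: (i == 0%N).
have [m nE] : exists m, n.+1 = m.*2 \/ n.+1 = m.*2.+1.
  by exists n.+1./2; have := odd_double_half n.+1; case: odd => /= nE; [right|left]; lia.
have evenE k j : (stern t k.*2)`_j =
    if ((0 < j) && (t %| j.-1))%N then (stern t k)`_(j.-1 %/ t) else 0.
  by rewrite stern_double coefXM; case: j => //= j; rewrite coef_comp_poly_Xn.
have oddE k j : (stern t k.*2.+1)`_j =
    if (t %| j)%N then (stern t k.+1)`_(j %/ t) + (stern t k)`_(j %/ t) else 0.
  by rewrite stern_doubleS coefD !coef_comp_poly_Xn //; case: ifP; rewrite ?addr0.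
have excl : (t %| i)%N -> ((0 < i) && (t %| i.-1))%N -> False.
  case: i => // i /= ti1 ti; have : (t %| 1)%N by rewrite -(dvdn_addr _ ti) addn1.
  by rewrite dvdn1; lia.
case: nE => nE; rewrite nE.
  have mn : (m < n.+1)%N by lia.
  rewrite evenE oddE; case: ifP => c1; case: ifP => c2.
  - by have := excl c2 c1.
  - by have [h0 h1 h2] := IH m mn (i.-1 %/ t)%N; split=> //; lia.
  - by have [h0 h1 h2] := IH m mn (i %/ t)%N; split=> //; lia.
  - by split.
have mn : (m < n.+1)%N by lia.
rewrite -[m.*2.+2]/(m.+1.*2) evenE oddE; case: ifP => c1; case: ifP => c2.
- by have := excl c1 c2.
- by have [h0 h1 h2] := IH m mn (i %/ t)%N; split=> //; lia.
- have [h0 h1 h2] := IH m mn (i.-1 %/ t)%N; split=> //; lia.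
- by split.
Qed.

Lemma stern_coef01 n i : 0 <= (stern t n)`_i <= 1.
Proof. by have [h0 h1 h2] := stern_coef n i; apply/andP; split=> //; lia. Qed.

Lemma stern_pred_pow2_coef0 k : (0 < k)%N -> (stern t (2 ^ k - 1))`_0 = 1.
Proof.
have t0 : (0 < t)%N by lia.
elim: k => // -[_ _|k IH _]; first by rewrite expn1 stern1 coef1.
have -> : (2 ^ k.+2 - 1 = (2 ^ k.+1 - 1).*2.+1)%N.
  by rewrite [(2 ^ k.+2)%N]expnS; have := expn_gt0 2 k.+1; lia.
rewrite stern_doubleS coefD !coef0_comp // IH //.
have -> : (2 ^ k.+1 - 1).+1 = (2 ^ k.+1)%N by have := expn_gt0 2 k.+1; lia.
by rewrite expnS mul2n stern_double coefXM.
Qed.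
End Stern.

Section Alpha.
Variable k : nat.

Lemma alphan0 : alphan k 0 = 0%N.
Proof.
have := alphanE k 0; rewrite muln0 !expr0 subrr => /eqP.
by rewrite mulf_eq0 => /orP[/eqP[]//|/eqP]; have := exprn_ge0 k (isT : 0 <= 2 :> int); lia.
Qed.

Lemma alphanS n : (alphan k n.+1)%:Z = 2 ^+ k * (alphan k n)%:Z + (-1) ^+ n.
Proof.
have d0 : (2 ^+ k + 1 : int) != 0 by have := exprn_ge0 k (isT : 0 <= 2 :> int); lia.
apply: (mulIf d0); rewrite mulrDl -mulrA !alphanE mulnS exprD exprS; ring.
Qed.

Lemma alphan_even n : ~~ odd n ->
  alphan k n.+1 = (2 ^ k * alphan k n + 1)%N.
Proof.
move=> no; have := alphanS n; rewrite -signr_odd (negPf no) expr0.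
by rewrite -[2 ^+ k]/((2%:Z) ^+ k) -rmorphXn /= => ?; apply/eqP; rewrite -eqz_nat PoszD PoszM; lia.
Qed.

Lemma alphan_odd n : odd n ->
  (alphan k n.+1 + 1 = 2 ^ k * alphan k n)%N.
Proof.
move=> no; have := alphanS n; rewrite -signr_odd no expr1.
by rewrite -[2 ^+ k]/((2%:Z) ^+ k) -rmorphXn /= => ?; apply/eqP; rewrite -eqz_nat PoszD PoszM; lia.
Qed.

Lemma alphan1 : alphan k 1 = 1%N.
Proof. by rewrite alphan_even // alphan0 muln0. Qed.
End Alpha.

(** * The approximating polynomials *)

Section Convergents.
Variables t k : nat.
Hypothesis t_gt1 : (2 <= t)%N.
Hypothesis k_gt0 : (1 <= k)%N.

Definition hpoly n : {poly int} := stern t (alphan k n).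

Lemma pow_gt1 : (1 < t ^ k)%N.
Proof. by rewrite -(expn0 t) ltn_exp2l. Qed.

Lemma stern_mul_pow2 n :
  stern t (2 ^ k * n) = stern t (2 ^ k) * (stern t n \Po 'X^(t ^ k)).
Proof. by have := stern_block t n (leq0n (2 ^ k)); rewrite addn0 subn0 stern0 mul0r addr0. Qed.

(** One of [alphan k n.+2 - 1] and [alphan k n.+2 + 1] is [2 ^ k] times
    [alphan k n.+1], so [stern_block] applies with [j = 1] or [j = 2 ^ k - 1]. *)
Lemma hpoly_rec n : hpoly n.+2 =
  stern t (2 ^ k - 1) * (hpoly n.+1 \Po 'X^(t ^ k)) +
  (stern t (2 ^ k) \Po 'X^(t ^ k)) * ((hpoly n \Po 'X^(t ^ k)) \Po 'X^(t ^ k)).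
Proof.
have k2 : (0 < 2 ^ k)%N by rewrite expn_gt0.
rewrite /hpoly; have [no|no] := boolP (odd n).
  rewrite alphan_even ?stern_block //= ?no // stern1 mul1r -[(alphan k n.+1).+1]addn1 alphan_odd //.
  by rewrite stern_mul_pow2 rmorphM.
have -> : alphan k n.+2 = (2 ^ k * (2 ^ k * alphan k n) + (2 ^ k - 1))%N.
  have : (alphan k n.+2 + 1 = 2 ^ k * alphan k n.+1)%N by rewrite alphan_odd.
  by rewrite (@alphan_even k n) // mulnDr muln1; lia.
rewrite stern_block ?leq_subr // subKn // stern1 mul1r (@alphan_even k n) //.
rewrite -[(2 ^ k * alphan k n).+1]addn1.
by rewrite stern_mul_pow2 rmorphM addrC.
Qed.

Lemma hpoly0 : hpoly 0 = 0. Proof. by rewrite /hpoly alphan0 stern0. Qed.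
Lemma hpoly1 : hpoly 1 = 1. Proof. by rewrite /hpoly alphan1 stern1. Qed.

Lemma stern_pow2_comp : exists2 e, (2 <= e)%N &
  stern t (2 ^ k) \Po 'X^(t ^ k) = 'X^e.
Proof.
have [m [m0 mE]] := stern_pow2_exp t k.
exists (t ^ k * m)%N; last by rewrite mE rmorphXn /= comp_polyX -exprM.
by have := pow_gt1; have := m0 k_gt0; nia.
Qed.

Lemma hpoly_coef0 n : (hpoly n.+1)`_0 = 1.
Proof.
have T0 : (0 < t ^ k)%N := ltnW pow_gt1.
have [e e2 eE] := stern_pow2_comp.
elim: n => [|n IH]; first by rewrite hpoly1 coef1.
rewrite hpoly_rec eE coefD coefXnM (ltnW e2) addr0.
rewrite -[in LHS](horner_coef0 (_ * _)) hornerM !horner_coef0 coef0_comp // IH mulr1.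
exact: stern_pred_pow2_coef0.
Qed.

(** In the difference of two consecutive recurrences the substitution of the
    power [t ^ k] multiplies orders of vanishing, and the monomial in front of
    the last term makes up for its lower index. *)
Lemma hpoly_step n : zord n (hpoly n.+1 - hpoly n).
Proof.
have T1 := pow_gt1; have [e e2 eE] := stern_pow2_comp.
elim/ltn_ind: n => -[|[|n]] IH.
- by [].
- case=> // _; rewrite hpoly_rec hpoly0 !comp_poly0 mulr0 addr0 hpoly1 comp_polyC.
  by rewrite mulr1 coefB coef1 stern_pred_pow2_coef0 // subrr.
rewrite [X in _ - X](hpoly_rec n) (hpoly_rec n.+1) eE.
have -> (A x x' X y y' : {poly int}) : A * x + X * y - (A * x' + X * y') =
   A * (x - x') + X * (y - y') by ring.
rewrite -!comp_polyB; apply: zordD.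
  apply: zordMl; apply: (@zordW _ _ (t ^ k * n.+1)); last by apply/zord_comp/IH.
  by move: (t ^ k)%N T1 => T T1; nia.
have ze : zord e ('X^e : {poly int}) by apply/zordP; exists 1; rewrite mulr1.
apply: (@zordW _ _ (e + t ^ k * (t ^ k * n))); last first.
  by apply: zordM => //; do 2 apply: zord_comp; apply: IH; lia.
by rewrite -add2n leq_add // mulnA leq_pmull // muln_gt0 ltnW.
Qed.

Lemma hpoly_dist n m : (n <= m)%N -> zord n (hpoly m - hpoly n).
Proof.
move=> /subnK <-; elim: (m - n)%N => [|l IH]; first by rewrite subrr; apply: zord0.
rewrite addSn; have -> : hpoly (l + n).+1 - hpoly n =
  (hpoly (l + n).+1 - hpoly (l + n)) + (hpoly (l + n) - hpoly n) by ring.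
by apply: zordD => //; apply: zordW (@hpoly_step (l + n)); rewrite leq_addl.
Qed.

(** The coefficients are nonnegative and the constant one is 1. *)
Lemma stern_pred_pow2_at1 : exists s : nat, (0 < s)%N /\
  (stern t (2 ^ k - 1)).[1] = s%:R.
Proof.
set A := stern _ _; have A0 : A`_0 = 1 by apply: stern_pred_pow2_coef0.
have A1 : 1 <= A.[1].
  rewrite horner_coef; have : (0 < size A)%N.
    by rewrite size_poly_gt0; apply: contra_eq_neq A0 => ->; rewrite coef0 eq_sym oner_eq0.
  case: (size A) => // n _; rewrite big_ord_recl A0 expr0 mulr1 lerDl.
  apply: sumr_ge0 => i _; rewrite expr1n mulr1.
  by have /andP[] := stern_coef01 t_gt1 (2 ^ k - 1) (lift ord0 i).
by exists `|A.[1]|%N; split; rewrite ?natz; lia.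
Qed.
End Convergents.

(** * Weighted norms of integer polynomials *)

Section WeightedNorm.
Variable F : numFieldType.
Implicit Types (p q : {poly int}) (r z : F).

(** The l1 norm of the coefficients weighted by powers of [r]: it is
    submultiplicative and bounds the values on the disc of radius [r]. *)
Definition wnorm r p : F := \sum_(i < size p) `|p`_i|%:~R * r ^+ i.

Lemma wnorm_widen r p n : (size p <= n)%N ->
  wnorm r p = \sum_(i < n) `|p`_i|%:~R * r ^+ i.
Proof.
move=> pn; rewrite /wnorm (big_ord_widen n (fun i => `|p`_i|%:~R * r ^+ i) pn).
rewrite big_mkcond; apply: eq_bigr => i _; case: ltnP => // pi.
by rewrite nth_default // normr0 mul0r.
Qed.

Lemma wnorm_ge0 r p : 0 <= r -> 0 <= wnorm r p.
Proof. by move=> r0; apply: sumr_ge0 => i _; rewrite mulr_ge0 ?ler0z ?exprn_ge0. Qed.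

Lemma wnorm0 r : wnorm r 0 = 0.
Proof. by rewrite /wnorm size_poly0 big_ord0. Qed.

Lemma wnormD r p q : 0 <= r -> wnorm r (p + q) <= wnorm r p + wnorm r q.
Proof.
move=> r0; pose n := maxn (size p) (size q).
rewrite (wnorm_widen r (size_polyD p q)).
rewrite (wnorm_widen r (leq_maxl _ _ : (size p <= n)%N)).
rewrite (wnorm_widen r (leq_maxr _ _ : (size q <= n)%N)) -big_split /=.
apply: ler_sum => i _; rewrite -mulrDl ler_wpM2r ?exprn_ge0 //.
by rewrite coefD -intrD ler_int ler_normD.
Qed.

Lemma wnormN r p : wnorm r (- p) = wnorm r p.
Proof. by rewrite /wnorm size_polyN; apply: eq_bigr => i _; rewrite coefN normrN. Qed.

Lemma wnorm_sum r (I : Type) (s : seq I) (P : pred I) (f : I -> {poly int}) : 0 <= r ->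
  wnorm r (\sum_(i <- s | P i) f i) <= \sum_(i <- s | P i) wnorm r (f i).
Proof.
move=> r0; elim/big_rec2: _ => [|i y x _ IH]; first by rewrite wnorm0.
by apply: le_trans (wnormD _ _ r0) _; rewrite lerD2l.
Qed.

Lemma wnormZX r c i p : 0 <= r ->
  wnorm r (c *: ('X^i * p)) = `|c|%:~R * r ^+ i * wnorm r p.
Proof.
move=> r0; have sz : (size (c *: ('X^i * p)) <= i + size p)%N.
  apply: leq_trans (size_scale_leq _ _) (leq_trans (size_polyMleq _ _) _).
  by rewrite size_polyXn addSn.
rewrite (wnorm_widen r sz) big_split_ord /= big1 ?add0r => [|j _]; last first.
  by rewrite coefZ coefXnM ltn_ord mulr0 normr0 mul0r.
rewrite mulr_sumr; apply: eq_bigr => j _.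
rewrite coefZ coefXnM ltnNge leq_addr addKn normrM intrM exprD.
by rewrite mulrACA.
Qed.

Lemma wnormM r p q : 0 <= r -> wnorm r (p * q) <= wnorm r p * wnorm r q.
Proof.
move=> r0; rewrite -{1}(coefK p) poly_def mulr_suml mulr_suml.
apply: le_trans (wnorm_sum _ _ _ r0) _; apply: ler_sum => i _.
by rewrite -scalerAl wnormZX.
Qed.

Lemma wnormC r c : wnorm r c%:P <= `|c|%:~R.
Proof. by rewrite (wnorm_widen r (size_polyC_leq1 c)) big_ord1 coefC mulr1. Qed.

Lemma wnormX r p n : 0 <= r -> wnorm r (p ^+ n) <= wnorm r p ^+ n.
Proof.
move=> r0; elim: n => [|n IH]; first by rewrite !expr0 (le_trans (wnormC _ _)).
by rewrite !exprS (le_trans (wnormM _ _ r0)) // ler_wpM2l // wnorm_ge0.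
Qed.

Lemma wnorm_prod r (I : finType) (f : I -> {poly int}) : 0 <= r ->
  wnorm r (\prod_i f i) <= \prod_i wnorm r (f i).
Proof.
move=> r0; elim/big_rec2: _ => [|i y x _ IH]; first by rewrite (le_trans (wnormC _ _)).
by rewrite (le_trans (wnormM _ _ r0)) // ler_wpM2l // wnorm_ge0.
Qed.

Lemma wnorm_le r p n B : 0 <= r -> (size p <= n)%N ->
  (forall i, `|p`_i|%:~R <= B) -> wnorm r p <= B * \sum_(i < n) r ^+ i.
Proof.
move=> r0 pn pB; rewrite (wnorm_widen r pn) mulr_sumr.
by apply: ler_sum => i _; rewrite ler_wpM2r ?exprn_ge0.
Qed.

(** Schwarz's lemma for polynomials: [m] factors [z] come out, each of them
    worth [`|z| / r] of the norm. *)
Lemma horner_zord_le r m p z : 0 < r -> `|z| <= r -> zord m p ->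
  `|(map_poly intr p).[z]| <= (`|z| / r) ^+ m * wnorm r p.
Proof.
move=> r0 zr zp.
rewrite (@horner_coef_wide _ (size p)) ?size_poly //.
apply: le_trans (ler_norm_sum _ _ _) _; rewrite mulr_sumr; apply: ler_sum => i _.
have [im|mi] := ltnP i m.
  by rewrite coef_map /= (zp i im) normr0 !mul0r normr0 mulr0.
rewrite normrM normrX coef_map /= intr_norm mulrCA ler_wpM2l //.
have -> : (`|z| / r) ^+ m * r ^+ i = `|z| ^+ m * r ^+ (i - m).
  by rewrite -{1}(subnKC mi) exprD expr_div_n mulrA divfK // expf_neq0 // gt_eqF.
rewrite -{1}(subnKC mi) exprD ler_wpM2l ?exprn_ge0 //.
by rewrite lerXn2r ?nnegrE // ltW.
Qed.

End WeightedNorm.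

Lemma wnorm_le_coef (F : numFieldType) (r : F) (p q : {poly int}) : 0 <= r ->
  (forall i, `|p`_i| <= `|q`_i|) -> wnorm r p <= wnorm r q.
Proof.
move=> r0 pq; pose n := maxn (size p) (size q).
rewrite (wnorm_widen r (leq_maxl _ _ : (size p <= n)%N)).
rewrite (wnorm_widen r (leq_maxr _ _ : (size q <= n)%N)).
by apply: ler_sum => i _; rewrite ler_wpM2r ?exprn_ge0 // ler_int.
Qed.

(** * Norms and eigenvalues of integer matrices *)

Section MatrixNorm.
Variable D : nat.
Implicit Types A B : 'M[int]_D.

Definition mnorm A := (\sum_i \sum_j `|A i j|)%N.

Lemma mnormD A B : (mnorm (A + B) <= mnorm A + mnorm B)%N.
Proof.
rewrite /mnorm -big_split; apply: leq_sum => i _ /=.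
by rewrite -big_split; apply: leq_sum => j _ /=; rewrite mxE; move: (A i j) (B i j) => x y; lia.
Qed.

Lemma mnormZ (c : nat) A : mnorm (c%:Z *: A) = (c * mnorm A)%N.
Proof.
rewrite /mnorm big_distrr; apply: eq_bigr => i _ /=.
by rewrite big_distrr; apply: eq_bigr => j _ /=; rewrite mxE abszM.
Qed.

Lemma absz_sum (I : Type) (s : seq I) (f : I -> int) :
  (`|(\sum_(i <- s) f i)%R| <= \sum_(i <- s) `|f i|)%N.
Proof.
elim: s => [|i s IH]; first by rewrite !big_nil.
rewrite !big_cons; apply: leq_trans (leq_add (leqnn _) IH).
by move: (f i) (\sum_(j <- s) f j) => x y; lia.
Qed.

Lemma mnormM A B : (mnorm (A *m B) <= mnorm A * mnorm B)%N.
Proof.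
rewrite /mnorm big_distrl; apply: leq_sum => i _ /=.
apply: (@leq_trans (\sum_j \sum_k `|A i k| * `|B k j|)%N).
  apply: leq_sum => j _; rewrite mxE; apply: leq_trans (absz_sum _ _) _.
  by apply: leq_sum => k _; rewrite abszM.
rewrite exchange_big big_distrl; apply: leq_sum => k _ /=.
by rewrite -big_distrr leq_mul // [X in (_ <= X)%N](bigD1 k) //= leq_addr.
Qed.

Lemma mnorm_scalar (c : int) : mnorm c%:M = (D * `|c|)%N.
Proof.
rewrite /mnorm (eq_bigr (fun _ => `|c|%N)) ?sum_nat_const ?card_ord // => i _.
rewrite (bigD1 i) //= mxE eqxx big1 ?addn0 // => j ji.
by rewrite mxE eq_sym (negPf ji).
Qed.

Lemma leq_mnorm A i j : (`|A i j| <= mnorm A)%N.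
Proof. by rewrite /mnorm (bigD1 i) //= (bigD1 j) //= -addnA leq_addr. Qed.

Variable F : numFieldType.

(** Expand the determinant: the norm is submultiplicative and every entry of the
    characteristic matrix has norm at most [1 + mnorm A]. *)
Lemma wnorm_char_poly A :
  wnorm (1 : F) (char_poly A) <= (D`! * (1 + mnorm A) ^ D)%:R.
Proof.
have l01 : 0 <= 1 :> F by [].
rewrite /char_poly /determinant; apply: le_trans (wnorm_sum _ _ _ l01) _.
rewrite natrM -card_Sn -sum1_card natr_sum mulr_suml.
rewrite [X in _ <= X](eq_bigl xpredT) => [|s]; last by rewrite inE.
apply: ler_sum => s _; rewrite mul1r.
have -> : (-1) ^+ s * \prod_i char_poly_mx A i (s i) =
    (-1) ^+ s *: ('X^0 * \prod_i char_poly_mx A i (s i)) :> {poly int}.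
  by rewrite mul1r scaler_sign mulr_sign.
rewrite wnormZX // normrX normrN1 expr1n expr0 !mul1r.
apply: le_trans (wnorm_prod _ l01) _.
rewrite natrX -[X in _ ^+ X](card_ord D) -prodr_const; apply: ler_prod => i _.
rewrite wnorm_ge0 //= !mxE natrD; apply: le_trans (wnormD _ _ l01) _.
rewrite wnormN lerD //.
  case: (i == s i); rewrite ?mulr0n ?wnorm0 // mulr1n.
  rewrite -[ 'X ]mulr1 -['X]expr1 -[_ * _]scale1r wnormZX //.
  by rewrite normr1 expr1 !mul1r (le_trans (wnormC _ _)).
by rewrite (le_trans (wnormC _ _)) // -natr_absz ler_nat leq_mnorm.
Qed.

(** A nonzero eigenvalue of an integer matrix cannot be too small: the lowest
    nonzero coefficient of the characteristic polynomial is a nonzero integer. *)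
Lemma eigenvalue_lower_bound A (v : 'rV[F]_D) (q : F) :
  v != 0 -> q != 0 -> `|q| <= 1 -> v *m map_mx intr A = q *: v ->
  1 <= `|q| * (D`! * (1 + mnorm A) ^ D)%:R.
Proof.
move=> v0 q0 q1 vA; pose chi := char_poly A.
have rq : (map_poly intr chi).[q] = 0 :> F.
  apply/eqP; rewrite -/(root _ _) /chi map_char_poly -eigenvalue_root_char.
  by apply/eigenvalueP; exists v.
have exi : exists i, chi`_i != 0.
  exists D; have := char_poly_monic A; rewrite monicE lead_coefE size_char_poly /= => /eqP ->.
  exact: oner_neq0.
have [j cj jmin] := ex_minnP exi.
pose p := chi - chi`_j *: 'X^j.
have pE i : p`_i = if i == j then 0 else chi`_i.
  rewrite coefB coefZ coefXn; case: eqP => [->|_]; first by rewrite mulr1 subrr.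
  by rewrite mulr0 subr0.
have zp : zord j.+1 p.
  move=> i; rewrite ltnS pE; case: eqP => // /eqP ij il.
  apply/eqP; rewrite -[_ == _]negbK; apply: contraL (il) => /jmin ji.
  by rewrite -ltnNge ltn_neqAle eq_sym ij.
have pq : (map_poly intr p).[q] = - (chi`_j)%:~R * q ^+ j.
  by rewrite rmorphB /= hornerD rq add0r hornerN map_polyZ map_polyXn /= hornerZ hornerXn mulNr.
have := horner_zord_le ltr01 q1 zp.
rewrite pq divr1 normrM normrN normrX exprSr -mulrA mulrC ler_pM2l ?exprn_gt0 ?normr_gt0 //.
move=> le1; apply: le_trans (_ : `|(chi`_j)%:~R| <= _).
  by rewrite -intr_norm -[1]/(1%:~R) ler_int; lia.
apply: le_trans le1 _; rewrite ler_wpM2l //.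
apply: le_trans (wnorm_char_poly A); apply: wnorm_le_coef => // i.
by rewrite pE; case: ifP.
Qed.
End MatrixNorm.

(** * Algebraic numbers acting on a lattice *)

Section IntegerRepresentation.
Variables (F : numFieldType) (D : nat) (v : 'rV[F]_D) (m K : nat).
Hypothesis D_gt0 : (0 < D)%N.
Hypothesis m_le_K : (m <= K)%N.

(** The number [m ^ e * x] is the eigenvalue of an integer matrix with the fixed
    eigenvector [v]. The exponent [e] and the factor [c] control denominator and
    size together; they behave like the degree and the length of a polynomial
    expression, and replace the height. *)
Definition irep e c (x : F) := exists A : 'M[int]_D,
  v *m map_mx intr A = ((m ^ e)%:R * x) *: v /\ (mnorm A <= c * K ^ e)%N.

Lemma irepW e e' c c' x : (e <= e')%N -> (c <= c')%N -> irep e c x -> irep e' c' x.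
Proof.
move=> ee cc [A [vA nA]]; exists ((m ^ (e' - e))%N%:Z *: A); split.
  rewrite map_mxZ /= -scalemxAr vA scalerA mulrA -pmulrn -natrM -expnD subnK //.
rewrite mnormZ -{2}(subnK ee) expnD mulnCA leq_mul //.
  by case: (e' - e)%N => // n; rewrite leq_exp2r.
by apply: leq_trans nA _; rewrite leq_mul2r cc orbT.
Qed.

Lemma irepD e c c' x y : irep e c x -> irep e c' y -> irep e (c + c') (x + y).
Proof.
move=> [A [vA nA]] [B [vB nB]]; exists (A + B); split.
  by rewrite map_mxD mulmxDr vA vB mulrDr scalerDl.
by rewrite mulnDl (leq_trans (mnormD _ _)) // leq_add.
Qed.

Lemma irepM e e' c c' x y :
  irep e c x -> irep e' c' y -> irep (e + e') (c * c') (x * y).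
Proof.
move=> [A [vA nA]] [B [vB nB]]; exists (A *m B); split.
  rewrite map_mxM mulmxA vA -scalemxAl vB scalerA expnD natrM.
  by congr (_ *: _); rewrite mulrACA.
by rewrite expnD mulnACA (leq_trans (mnormM _ _)) // leq_mul.
Qed.

Lemma irepC (z : int) : irep 0 (D * `|z|) z%:~R.
Proof.
exists z%:M; split; last by rewrite mnorm_scalar muln1.
by rewrite map_scalar_mx mul_mx_scalar mul1r.
Qed.

Lemma irepN e c x : irep e c x -> irep e (c * D) (- x).
Proof.
move=> rx; have := irepM rx (irepC (-1)); rewrite addn0 muln1.
by rewrite mulrN1z mulrN1.
Qed.

Lemma irepX e c x n : irep e c x -> irep (n * e) (D * c ^ n) (x ^+ n).
Proof.
move=> rx; elim: n => [|n IH].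
  by have := irepC 1; rewrite absz_nat expr0 expn0 mul0n !muln1.
by have := irepM rx IH; rewrite exprS expnS mulSn mulnCA.
Qed.

Lemma irep_sum e (c : nat -> nat) (f : nat -> F) n :
  (forall i, (i < n)%N -> irep e (c i) (f i)) ->
  irep e (\sum_(i < n) c i) (\sum_(i < n) f i).
Proof.
elim: n => [|n IH] rf.
  rewrite !big_ord0; apply: (irepW (leq0n e) (leqnn _)).
  by have := irepC 0; rewrite absz_nat muln0.
by rewrite !big_ord_recr; apply: irepD; [apply: IH => i ?; apply: rf; lia|apply: rf].
Qed.

Lemma irep_horner (p : {poly int}) b e x : (size p <= b.+1)%N -> irep e 1 x ->
  forall n, irep (b * (n * e))
    (\sum_(i < b.+1) D * `|(p`_i)%R| * D)
    (map_poly intr p).[x ^+ n].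
Proof.
move=> sp rx n; rewrite (@horner_coef_wide _ b.+1); last first.
  exact: leq_trans (size_poly _ _) sp.
apply: (@irep_sum _ (fun i => D * `|(p`_i)%R| * D)%N
  (fun i => (map_poly intr p)`_i * (x ^+ n) ^+ i)) => i ib; rewrite coef_map /= -exprM.
have := irepM (irepC p`_i) (irepX (n * i) rx); rewrite exp1n muln1.
move=> r; by apply: (irepW _ (leqnn _) r); rewrite add0n [(n * i)%N]mulnC -mulnA leq_mul.
Qed.
End IntegerRepresentation.

Section GeneratingFamily.
Variables (F : numFieldType) (I : finType) (g : I -> F).

(** The integral span of a family; multiplication by a number that maps it into
    itself up to a denominator is given by an integer matrix. *)
Definition zspan y := exists c : I -> int, y = \sum_q (c q)%:~R * g q.

Lemma zspan_gen q : zspan (g q).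
Proof.
exists (fun q' => (q' == q)%:R); rewrite (bigD1 q) //= eqxx mul1r big1 ?addr0 //.
by move=> q' /negPf ->; rewrite mul0r.
Qed.

Lemma zspan0 : zspan 0.
Proof. by exists (fun=> 0); rewrite big1 // => q _; rewrite mul0r. Qed.

Lemma zspanD y z : zspan y -> zspan z -> zspan (y + z).
Proof.
move=> [c ->] [c' ->]; exists (fun q => c q + c' q); rewrite -big_split.
by apply: eq_bigr => q _; rewrite intrD mulrDl.
Qed.

Lemma zspanZ (z : int) y : zspan y -> zspan (z%:~R * y).
Proof.
move=> [c ->]; exists (fun q => z * c q); rewrite mulr_sumr.
by apply: eq_bigr => q _; rewrite intrM mulrA.
Qed.

Lemma zspan_sum n (f : 'I_n -> F) : (forall i, zspan (f i)) -> zspan (\sum_i f i).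
Proof. by move=> zf; apply: big_ind => //; [exact: zspan0|exact: zspanD]. Qed.

Definition gen_row : 'rV[F]_#|I| := \row_r g (enum_val r).

Lemma zspan_irep (m : nat) x : (forall q, zspan (m%:R * x * g q)) ->
  exists K, forall K', (K <= K')%N -> irep gen_row m K' 1 1 x.
Proof.
move=> /fin_all_exists[c cE].
pose A : 'M[int]_#|I| := \matrix_(r, s) c (enum_val s) (enum_val r).
exists (mnorm A) => K' KK; exists A; split; last by rewrite mul1n expn1.
apply/rowP => s; rewrite !mxE expn1 cE.
rewrite (reindex (@enum_val I I)); last by apply/onW_bij/enum_val_bij.
by apply: eq_bigr => r _; rewrite !mxE mulrC.
Qed.
End GeneratingFamily.

Lemma algebraic_int_equation (F : numFieldType) (x : F) : algebraicOver ratr x ->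
  exists n m (a : nat -> int), [/\ (0 < n)%N, (0 < m)%N &
    m%:R * x ^+ n = \sum_(i < n) (a i)%:~R * x ^+ i].
Proof.
move=> [p p0 rp]; have [q [d d0 pE]] := rat_poly_scale p.
have q0 : q != 0 by apply: contraNneq p0 => q0; rewrite pE q0 rmorph0 scaler0.
have rq : (map_poly intr q).[x] = 0 :> F.
  move: rp; rewrite pE map_polyZ rootE hornerZ mulf_eq0 fmorph_eq0 invr_eq0.
  rewrite intr_eq0 (negPf d0) /= -map_poly_comp => /eqP <-.
  by congr horner; apply: eq_map_poly => z /=; rewrite ratr_int.
have [n sq] : exists n, size q = n.+1.
  by exists (size q).-1; rewrite prednK // size_poly_gt0.
have l0 : q`_n != 0 by have := lead_coef_eq0 q; rewrite lead_coefE sq /= => ->.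
have E : (q`_n)%:~R * x ^+ n = - \sum_(i < n) (q`_i)%:~R * x ^+ i.
  apply/eqP; rewrite -addr_eq0 addrC; apply/eqP; move: rq.
  rewrite (@horner_coef_wide _ n.+1) -?sq ?size_poly // sq big_ord_recr /=.
  rewrite coef_map /= => rq; rewrite -[RHS]rq; congr (_ + _).
  by apply: eq_bigr => i _; rewrite coef_map.
exists n, `|(q`_n)%R|%N, (fun i => - Num.sg q`_n * q`_i); split.
- rewrite lt0n; apply: contra_neqN l0 => /eqP n0; move: E; rewrite n0 big_ord0 oppr0.
  by rewrite expr0 mulr1 => /eqP; rewrite intr_eq0 => /eqP.
- by rewrite absz_gt0.
have -> : (`|(q`_n)%R|%N)%:R = (Num.sg q`_n)%:~R * (q`_n)%:~R :> F.
  by rewrite natr_absz normrEsg intrM.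
rewrite -mulrA E mulrN -mulNr -intrN mulr_sumr; apply: eq_bigr => i _.
by rewrite mulrA -intrM.
Qed.

(** * A lower bound for nonzero algebraic numbers *)

(** Both numbers act on the lattice spanned by the products of their powers up to
    the degrees of integral equations. *)
Lemma algebraic_pair_irep (F : numFieldType) (x y : F) :
  algebraicOver ratr x -> algebraicOver ratr y ->
  exists D (v : 'rV[F]_D) m K, [/\ (0 < D)%N, v != 0, (0 < m <= K)%N,
    irep v m K 1 1 x & irep v m K 1 1 y].
Proof.
move=> /algebraic_int_equation[n [a [f [n0 a0 xE]]]].
move=> /algebraic_int_equation[l [b [g [l0 b0 yE]]]].
pose I := ('I_n * 'I_l)%type.
pose w (p : I) : F := x ^+ p.1 * y ^+ p.2.
have w1 : w (Ordinal n0, Ordinal l0) = 1 by rewrite /w /= !expr0 mulr1.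
pose m := (a * b)%N.
have zx q : zspan w (m%:R * x * w q).
  case: q => [i j]; rewrite /w /=; have [lt|ge] := ltnP i.+1 n.
    have -> : m%:R * x * (x ^+ i * y ^+ j) = m%:Z%:~R * w (Ordinal lt, j).
      by rewrite /w /= exprS pmulrn; ring.
    by apply/zspanZ/zspan_gen.
  have iE : n = i.+1 by apply/eqP; rewrite eqn_leq ge ltn_ord.
  have -> : m%:R * x * (x ^+ i * y ^+ j) =
      \sum_(k < n) (b%:Z%:~R * (f k)%:~R) * w (k, j).
    have xn : x ^+ n = x * x ^+ i by rewrite -exprS -iE.
    transitivity (b%:R * (a%:R * x ^+ n) * y ^+ j).
      by rewrite /m natrM xn; ring.
    rewrite xE mulr_sumr mulr_suml; apply: eq_bigr => k _.
    by rewrite /w /= -pmulrn !mulrA.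
  by apply: zspan_sum => k; rewrite -intrM; apply/zspanZ/zspan_gen.
have zy q : zspan w (m%:R * y * w q).
  case: q => [i j]; rewrite /w /=; have [lt|ge] := ltnP j.+1 l.
    have -> : m%:R * y * (x ^+ i * y ^+ j) = m%:Z%:~R * w (i, Ordinal lt).
      by rewrite /w /= exprS pmulrn; ring.
    by apply/zspanZ/zspan_gen.
  have jE : l = j.+1 by apply/eqP; rewrite eqn_leq ge ltn_ord.
  have -> : m%:R * y * (x ^+ i * y ^+ j) =
      \sum_(k < l) (a%:Z%:~R * (g k)%:~R) * w (i, k).
    have yl : y ^+ l = y * y ^+ j by rewrite -exprS -jE.
    transitivity (a%:R * (b%:R * y ^+ l) * x ^+ i).
      by rewrite /m natrM yl; ring.
    rewrite yE mulr_sumr mulr_suml; apply: eq_bigr => k _.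
    by rewrite /w /= -pmulrn [x ^+ i * _]mulrC !mulrA.
  by apply: zspan_sum => k; rewrite -intrM; apply/zspanZ/zspan_gen.
have [K1 K1P] := zspan_irep zx; have [K2 K2P] := zspan_irep zy.
exists #|{: I}|, (gen_row w), m, (maxn m (maxn K1 K2)); split.
- by rewrite card_prod !card_ord muln_gt0 n0 l0.
- apply/eqP => /rowP/(_ (enum_rank (Ordinal n0, Ordinal l0))).
  by rewrite !mxE enum_rankK w1 => /eqP; rewrite oner_eq0.
- by rewrite muln_gt0 a0 b0 leq_maxl.
- by apply: K1P; lia.
- by apply: K2P; lia.
Qed.

(** Liouville's inequality, from [eigenvalue_lower_bound]. *)
Lemma irep_lower_bound (F : numFieldType) D (v : 'rV[F]_D) m K e c (q : F) :
  v != 0 -> (0 < m <= K)%N -> irep v m K e c q -> q != 0 ->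
  1 <= `|q| * (D`! * (1 + c) ^ D)%:R * ((K ^ D.+1) ^ e)%:R.
Proof.
move=> v0 /andP[m0 mK] [A [vA nA]] q0.
have K0 : (0 < K)%N by apply: leq_trans mK.
pose x : F := (m ^ e)%:R * q.
have x0 : x != 0 by rewrite mulf_neq0 // pnatr_eq0 expn_eq0; case: m m0 {mK x vA}.
have bound : 1 <= `|x| * (D`! * (1 + mnorm A) ^ D)%:R.
  have [x1|x1] := real_leP (normr_real x) (real1 F);
    first exact: (eigenvalue_lower_bound v0 x0 x1 vA).
  apply: (le_trans (ltW x1)); rewrite ler_peMr // ler1n muln_gt0 fact_gt0.
  by rewrite expn_gt0.
apply: (le_trans bound); rewrite normrM normr_nat [(m ^ e)%:R * _]mulrC -!mulrA.
rewrite ler_wpM2l // -!natrM ler_nat.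
have -> : ((K ^ D.+1) ^ e = K ^ e * (K ^ e) ^ D)%N.
  by rewrite -!expnM -expnD mulSn [(D * e)%N]mulnC.
have leq_exp a b n : (a <= b)%N -> (a ^ n <= b ^ n)%N.
  by case: n => // n; rewrite leq_exp2r.
have c1 : (1 + mnorm A <= (1 + c) * K ^ e)%N.
  by rewrite mulnDl mul1n leq_add // expn_gt0 K0.
have := leq_exp _ _ D c1; rewrite expnMn => c2.
apply: (@leq_trans (K ^ e * (D`! * ((1 + c) ^ D * (K ^ e) ^ D)))).
  by rewrite leq_mul ?leq_mul ?leq_exp.
rewrite [(K ^ e * (K ^ e) ^ D)%N]mulnC !mulnA [(K ^ e * _)%N]mulnC -!mulnA.
by rewrite leq_eqVlt; apply/orP; left; apply/eqP; ring.
Qed.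

(** * Auxiliary forms *)

(** Siegel's lemma, without a bound for the solution. *)
Lemma integer_kernel (I : finType) n (f : I -> 'I_n -> int) : (n < #|I|)%N ->
  exists2 c : I -> int, (exists i, c i != 0) & forall j, \sum_i c i * f i j = 0.
Proof.
move=> nI; pose A : 'M[rat]_(#|I|, n) := \matrix_(r, j) (f (enum_val r) j)%:~R.
have : kermx A != 0.
  rewrite kermx_eq0 /row_free neq_ltn (leq_ltn_trans (rank_leq_col A)) //.
case/rowV0Pn => v /sub_kermxP vA v0.
have [q [d d0 pE]] := rat_poly_scale (rVpoly v).
have vE r : v 0 r = d%:~R^-1 * (q`_r)%:~R.
  by rewrite -coef_rVpoly_ord pE coefZ coef_map.
have dr0 : d%:~R != 0 :> rat by rewrite intr_eq0.
exists (fun i => q`_(enum_rank i)).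
  have /rV0Pn[r vr] : v != 0 by [].
  exists (enum_val r); rewrite enum_valK; apply: contraNneq vr => qr.
  by rewrite vE qr mulr0.
move=> j; apply: (@intr_inj rat); apply: (mulfI (_ : d%:~R^-1 != 0)).
  by rewrite invr_eq0.
have /rowP/(_ j) := vA; rewrite !mxE mulr0 => <-.
rewrite rmorph_sum mulr_sumr (reindex (@enum_val I I)) /=; last first.
  exact/onW_bij/enum_val_bij.
apply: eq_bigr => r _.
by rewrite mxE vE enum_valK intrM mulrA.
Qed.

(** There are [(N + 1) ^ 2] coefficients to choose and [N ^ 2] conditions. *)
Lemma auxiliary_form N (X Y : {poly int}) :
  exists p : {poly {poly int}}, [/\ p != 0, (size p <= N.+1)%N,
    forall i, (size (p`_i)%R <= N.+1)%N & zord (N ^ 2) (form_eval N p X Y)].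
Proof.
pose I := ('I_N.+1 * 'I_N.+1)%type.
pose f (q : I) : {poly int} := 'X^(q.2) * (X ^+ q.1 * Y ^+ (N - q.1)).
have [|c [[i0 j0] c0] cE] := @integer_kernel I (N ^ 2) (fun q j => (f q)`_j).
  by rewrite card_prod card_ord -[X in (_ < X)%N]/(N.+1 ^ 2)%N ltn_exp2r.
pose P : {poly {poly int}} :=
  \poly_(i < N.+1) \poly_(j < N.+1) c (inord i, inord j).
have PE (i : 'I_N.+1) : P`_i = \poly_(j < N.+1) c (i, inord j).
  by rewrite coef_poly ltn_ord inord_val.
exists P; split.
- apply: contraNneq c0 => P0; have := PE i0; rewrite P0 coef0.
  move/(congr1 (fun p : {poly int} => p`_j0)).
  by rewrite coef0 coef_poly ltn_ord inord_val => <-.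
- exact: size_poly.
- move=> i; rewrite coef_poly; case: ifP => _; last by rewrite size_poly0.
  exact: size_poly.
move=> l lN; rewrite -[RHS](cE (Ordinal lN)) /form_eval coef_sum.
have -> : \sum_i c i * (f i)`_(Ordinal lN) =
    \sum_(i < N.+1) \sum_(j < N.+1) c (i, j) * (f (i, j))`_l.
  by rewrite pair_bigA; apply: eq_bigr => -[].
apply: eq_bigr => i _; rewrite PE poly_def -mulrA mulr_suml.
etransitivity; first exact: coef_sum.
by apply: eq_bigr => j _; rewrite inord_val -scalerAl coefZ.
Qed.

(** * Limits *)

Local Notation Re := complex.Re.
Local Notation Im := complex.Im.

Section Limits.
Variable F : numFieldType.
Implicit Types (u w : nat -> F) (x y : F).

Definition tends u x := forall e, 0 < e -> exists N, forall n, (N <= n)%N -> `|x - u n| < e.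

Lemma tendsP u x : tends u x <-> (u @ \oo --> x)%classic.
Proof.
split=> [ux|/cvgrPdist_lt ux e e0].
  by apply/cvgrPdist_lt => e /ux[N NP]; exists N => // n /NP.
by have [N _ NP] := ux e e0; exists N => n /NP.
Qed.

Lemma tends_lim u x : tends u x -> lim (u @ \oo)%classic = x.
Proof. by move=> /tendsP; apply: cvg_lim; apply: norm_hausdorff. Qed.

Lemma tends_unique u x y : tends u x -> tends u y -> x = y.
Proof. by move=> /tends_lim <- /tends_lim. Qed.

Lemma tends_cst x : tends (fun=> x) x.
Proof. by apply/tendsP; apply: cvg_cst. Qed.

Lemma tendsD u w x y : tends u x -> tends w y -> tends (fun n => u n + w n) (x + y).
Proof. by move=> /tendsP ux /tendsP wy; apply/tendsP; apply: cvgD. Qed.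

Lemma tendsM u w x y : tends u x -> tends w y -> tends (fun n => u n * w n) (x * y).
Proof. by move=> /tendsP ux /tendsP wy; apply/tendsP; apply: cvgM. Qed.

Lemma tendsV u x : x != 0 -> tends u x -> tends (fun n => (u n)^-1) x^-1.
Proof. by move=> x0 /tendsP ux; apply/tendsP; apply: cvgV. Qed.

Lemma tendsX u x k : tends u x -> tends (fun n => u n ^+ k) (x ^+ k).
Proof.
move=> ux; elim: k => [|k IH]; first exact: tends_cst.
under [X in tends X]funext => n do rewrite exprS.
by rewrite exprS; apply: tendsM.
Qed.

Lemma tends_sum k (f : 'I_k -> nat -> F) (l : 'I_k -> F) :
  (forall i, tends (f i) (l i)) -> tends (fun n => \sum_i f i n) (\sum_i l i).
Proof.
elim: k f l => [|k IH] f l fl.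
  under [X in tends X]funext => n do rewrite big_ord0.
  by rewrite big_ord0; apply: tends_cst.
under [X in tends X]funext => n do rewrite big_ord_recl.
by rewrite big_ord_recl; apply: tendsD => //; apply: IH.
Qed.

Lemma tends_shift u x k : tends u x -> tends (fun n => u (n + k)%N) x.
Proof.
move=> ux e /ux[N NP]; exists N => n Nn; apply: NP.
exact: leq_trans Nn (leq_addr _ _).
Qed.

Lemma tends_form_eval d (p : {poly F}) u w x y :
  tends u x -> tends w y -> tends (fun n => form_eval d p (u n) (w n)) (form_eval d p x y).
Proof.
move=> ux wy; apply: tends_sum => i; apply: tendsM; last exact: tendsX.
by apply: tendsM; [apply: tends_cst|apply: tendsX].
Qed.

Lemma tends_norm_le u x B N : tends u x -> (forall n, (N <= n)%N -> `|u n| <= B) ->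
  `|x| <= B.
Proof.
move=> ux uB; apply/ler_addgt0Pr => e /ux[M MP].
have := MP _ (leq_maxl M N); have := uB _ (leq_maxr M N).
set n := maxn _ _ => un xn; rewrite -(subrK (u n) x) addrC.
by apply: le_trans (ler_normD _ _) _; rewrite lerD // ltW.
Qed.

Lemma tends_norm_ge u x B N : tends u x -> (forall n, (N <= n)%N -> B <= `|u n|) ->
  B <= `|x|.
Proof.
move=> ux uB; apply/ler_addgt0Pr => e /ux[M MP].
have := MP _ (leq_maxl M N); have := uB _ (leq_maxr M N).
set n := maxn _ _ => un xn; apply: le_trans un _.
rewrite -[X in `|X|](subrK x) addrC; apply: le_trans (ler_normD _ _) _.
by rewrite lerD // distrC ltW.
Qed.

Lemma tends_neq0 u x : tends u x -> x != 0 ->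
  exists N, forall n, (N <= n)%N -> u n != 0.
Proof.
move=> ux x0; have [|N NP] := ux `|x|; first by rewrite normr_gt0.
exists N => n /NP; apply: contraTneq => ->; rewrite subr0 ltxx //.
Qed.
End Limits.

Section ComplexLimits.
Local Open Scope complex_scope.
Variable R : realType.
Implicit Types (u w : nat -> R[i]) (x y : R[i]).

Lemma real_complexE x : 0 <= x -> x = (Re x)%:C.
Proof. by move=> x0; rewrite RRe_real // ger0_real. Qed.

Lemma expr_small x e : 0 <= x < 1 -> 0 < e ->
  exists N, forall n, (N <= n)%N -> x ^+ n < e.
Proof.
move=> /andP[x0 x1] e0; rewrite (real_complexE x0) (real_complexE (ltW e0)).
have r1 : `|Re x| < 1.
  by move: x0 x1; rewrite lecE ltcE /= => /andP[_ x0] /andP[_]; rewrite ger0_norm.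
have re0 : 0 < Re e by move: e0; rewrite ltcE /= => /andP[].
have /cvgrPdist_lt/(_ _ re0)[N _ NP] := cvg_expr r1.
exists N => n Nn; rewrite -rmorphXn /= ltcR.
by have := NP n Nn; rewrite /= sub0r normrN; apply: le_lt_trans; rewrite ler_norm.
Qed.

Lemma normi : `|'i%C| = 1 :> R[i].
Proof. by rewrite normc_def /= expr0n expr1n add0r sqrtr1. Qed.

Lemma normc_real (a : R) : `|a%:C| = `|a|%:C.
Proof. by rewrite normc_def /= expr0n addr0 sqrtr_sqr. Qed.

Lemma real_geometric_cvg (v : nat -> R) (r K : R) : 0 <= r < 1 ->
  (forall n m, (n <= m)%N -> `|v m - v n| <= K * r ^+ n) ->
  exists l : R, (v @ \oo --> l)%classic.
Proof.
move=> /andP[r0 r1] vK; suff : cvg (v @ \oo)%classic by exists (lim (v @ \oo))%classic.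
apply: cauchy_cvg; apply: cauchy_exP => e e0.
have nr1 : `|r| < 1 by rewrite ger0_norm.
have : (K * r ^+ n @[n --> \oo] --> K * 0)%classic by apply: cvgMr; exact: cvg_expr.
rewrite mulr0 => /cvgrPdist_lt/(_ _ e0)[N _ NP].
exists (v N); exists N => // m /= Nm; rewrite /ball /= distrC.
apply: le_lt_trans (vK _ _ Nm) _; have := NP N (leqnn N).
by rewrite /= sub0r normrN; apply: le_lt_trans; rewrite ler_norm.
Qed.

Lemma geometric_cvg u (r K : R[i]) : 0 <= r < 1 -> 0 <= K ->
  (forall n m, (n <= m)%N -> `|u m - u n| <= K * r ^+ n) ->
  exists l, tends u l.
Proof.
move=> /andP[r0 r1] K0 uK.
have rr : 0 <= Re r < 1.
  by move: r0 r1; rewrite lecE ltcE /= => /andP[_ ->] /andP[].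
have bnd n : K * r ^+ n = (Re K * Re r ^+ n)%:C.
  by rewrite {1}(real_complexE K0) {1}(real_complexE r0) -rmorphXn -rmorphM.
have le_Re (z : R[i]) : `|Re z|%:C <= `|z| by exact: normc_ge_Re.
have le_Im (z : R[i]) : `|Im z|%:C <= `|z|.
  have -> : Im z = Re (- 'i%C * z) by case: z => a b; simpc.
  by rewrite (le_trans (le_Re _)) // normrM normrN normi mul1r.
have [a ua] : exists l : R, ((fun n => Re (u n)) @ \oo --> l)%classic.
  apply: (real_geometric_cvg (K := Re K) rr) => n m nm.
  rewrite -lecR -bnd; apply: le_trans (uK _ _ nm).
  by apply: le_trans (le_Re _); rewrite raddfB.
have [b ub] : exists l : R, ((fun n => Im (u n)) @ \oo --> l)%classic.
  apply: (real_geometric_cvg (K := Re K) rr) => n m nm.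
  rewrite -lecR -bnd; apply: le_trans (uK _ _ nm).
  by apply: le_trans (le_Im _); rewrite raddfB.
exists (a +i* b) => e e0; rewrite (real_complexE (ltW e0)).
have e20 : 0 < Re e / 2 by rewrite divr_gt0 //; move: e0; rewrite ltcE /= => /andP[].
have /cvgrPdist_lt/(_ _ e20)[N1 _ N1P] := ua.
have /cvgrPdist_lt/(_ _ e20)[N2 _ N2P] := ub.
exists (maxn N1 N2) => n; rewrite geq_max => /andP[/N1P /= n1 /N2P /= n2].
have -> : a +i* b - u n = (a - Re (u n))%:C + 'i%C * (b - Im (u n))%:C.
  by case: (u n) => c d; simpc.
apply: le_lt_trans (ler_normD _ _) _; rewrite normrM normi mul1r !normc_real.
by rewrite -rmorphD ltcR [X in _ < X]splitr ltrD.
Qed.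
End ComplexLimits.

(** * Values of the approximating polynomials and of their limit *)

Lemma geometric_sum_le (F : numFieldType) (r : F) n : 0 <= r < 1 ->
  \sum_(i < n) r ^+ i <= (1 - r)^-1.
Proof.
move=> /andP[r0 r1]; have d0 : 0 < 1 - r by rewrite subr_gt0.
rewrite -(ler_pM2l d0) divff ?gt_eqF //.
have -> : (1 - r) * \sum_(i < n) r ^+ i = 1 - r ^+ n.
  by rewrite -opprB mulNr -subrX1 opprB.
by rewrite gerBl exprn_ge0.
Qed.

Lemma half_bound (F : numFieldType) (x : F) : x <= 8%:R^-1 ->
  (1 - 2%:R^-1)^-1 * (x / 2%:R^-1) ^+ 1 <= 2%:R^-1.
Proof.
move=> x8; have -> : (1 - 2%:R^-1)^-1 * (x / 2%:R^-1) ^+ 1 = 4%:R * x by field.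
apply: le_trans (ler_wpM2l (ler0n _ 4) x8) _.
by rewrite le_eqVlt (_ : 4%:R / 8%:R = 2%:R^-1) ?eqxx //; field.
Qed.

(** The part of completeness that is used: it lets the complex numbers enter only
    at the very end. *)
Definition geometrically_complete (F : numFieldType) := forall (u : nat -> F) (r K : F),
  0 <= r < 1 -> 0 <= K ->
  (forall n m, (n <= m)%N -> `|u m - u n| <= K * r ^+ n) -> exists l, tends u l.

Section Evaluation.
Variables (C : numFieldType) (t k : nat).
Hypothesis t_gt1 : (2 <= t)%N.
Hypothesis k_gt0 : (1 <= k)%N.
Local Notation T := (t ^ k)%N.
Local Notation h := (hpoly t k).
Hypothesis C_complete : geometrically_complete C.
Implicit Types z r : C.

Definition hval n z : C := (map_poly intr (h n)).[z].
Definition aval z : C := (map_poly intr (stern t (2 ^ k - 1))).[z].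

Lemma hval0 z : hval 0 z = 0.
Proof. by rewrite /hval hpoly0 rmorph0 horner0. Qed.

Lemma hval1 z : hval 1 z = 1.
Proof. by rewrite /hval hpoly1 rmorph1 hornerC. Qed.

Lemma hval_rec : exists2 e, (2 <= e)%N &
  (forall z, stern_at t (2 ^ k) (z ^+ T) = z ^+ e) /\
  forall n z, hval n.+2 z =
    aval z * hval n.+1 (z ^+ T) + z ^+ e * hval n ((z ^+ T) ^+ T).
Proof.
have [e e2 eE] := stern_pow2_comp t_gt1 k_gt0.
have comp (p : {poly int}) (z : C) :
    (map_poly intr (p \Po 'X^T)).[z] = (map_poly intr p).[z ^+ T].
  by rewrite map_comp_poly map_polyXn horner_comp hornerXn.
exists e => //; split=> [z|n z].
  by rewrite /stern_at -comp eE map_polyXn hornerXn.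
rewrite /hval hpoly_rec // rmorphD !rmorphM /= hornerD !hornerM !comp.
by congr (_ + _ * _); rewrite -comp eE map_polyXn hornerXn.
Qed.

Lemma wnorm_hdiff r n m : 0 <= r < 1 -> wnorm r (h m - h n) <= (1 - r)^-1.
Proof.
move=> r01; have /andP[r0 _] := r01.
apply: (le_trans _ (geometric_sum_le (size (h m - h n)) r01)).
rewrite -[X in _ <= X]mul1r; apply: wnorm_le => // i.
have /andP[a0 a1] := stern_coef01 t_gt1 (alphan k m) i.
have /andP[b0 b1] := stern_coef01 t_gt1 (alphan k n) i.
rewrite -[1]/(1%:~R) ler_int coefB ler_norml /hpoly.
by move: a0 a1 b0 b1; move: (stern t _)`_i (stern t _)`_i => a b; lia.
Qed.

Lemma hval_dist z r n m : `|z| <= r -> 0 < r < 1 -> (n <= m)%N ->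
  `|hval m z - hval n z| <= (1 - r)^-1 * (`|z| / r) ^+ n.
Proof.
move=> zr /andP[r0 r1] nm; rewrite mulrC.
have -> : hval m z - hval n z = (map_poly intr (h m - h n)).[z].
  by rewrite rmorphB hornerD hornerN.
apply: le_trans (horner_zord_le r0 zr (hpoly_dist t_gt1 k_gt0 nm)) _.
rewrite ler_wpM2l ?exprn_ge0 ?divr_ge0 ?(ltW r0) //.
by rewrite wnorm_hdiff // (ltW r0).
Qed.

Lemma Hk_tends z : `|z| < 1 -> tends (fun n => hval n z) (Hk t k z).
Proof.
move=> z1; pose r := (1 + `|z|) / 2%:R.
have r0 : 0 < r by rewrite divr_gt0 // ltr_wpDr.
have zr : `|z| < r by rewrite ltr_pdivlMr // mulr_natr mulr2n ltrD2r.
have r1 : r < 1 by rewrite ltr_pdivrMr // mul1r -[2%:R]/(1 + 1) ltrD2l.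
have [l hl] : exists l, tends (fun n => hval n z) l.
  apply: (C_complete (r := `|z| / r) (K := (1 - r)^-1)).
  - by rewrite divr_ge0 ?(ltW r0) //= ltr_pdivrMr // mul1r.
  - by rewrite invr_ge0 subr_ge0 ltW.
  - by move=> n m nm; apply: hval_dist => //; rewrite ?(ltW zr) ?r0.
suff -> : Hk t k z = l by [].
exact: tends_lim hl.
Qed.

Lemma norm_expT_lt1 z n : `|z| < 1 -> (0 < n)%N -> `|z ^+ n| < 1.
Proof. by move=> z1 n0; rewrite normrX exprn_ilt1 // -lt0n. Qed.

Lemma Hk_eq z : `|z| < 1 -> forall e,
  (forall z, stern_at t (2 ^ k) (z ^+ T) = z ^+ e :> C) ->
  Hk t k z = aval z * Hk t k (z ^+ T) + z ^+ e * Hk t k ((z ^+ T) ^+ T).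
Proof.
move=> z1 e eE; have [e' _ [eE' rec]] := hval_rec.
have T0 : (0 < T)%N by apply: ltnW; apply: pow_gt1.
have zT1 : `|z ^+ T| < 1 by apply: norm_expT_lt1.
have zTT1 : `|(z ^+ T) ^+ T| < 1 by apply: norm_expT_lt1.
apply: (tends_unique (tends_shift 2 (Hk_tends z1))).
have := tendsD (tendsM (tends_cst (aval z)) (tends_shift 1 (Hk_tends zT1)))
  (tendsM (tends_cst (z ^+ e)) (Hk_tends zTT1)).
move=> H ep /H[N NP]; exists N => n /NP; rewrite addn2 rec addn1.
by rewrite -eE' eE.
Qed.

(** The constant term is 1 and the other coefficients are 0 or 1. *)
Lemma hval_near1 z n : `|z| <= 8%:R^-1 -> `|hval n.+1 z - 1| <= 2%:R^-1.
Proof.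
move=> z8; rewrite -[X in _ - X](hval1 z).
have h01 : 0 < (2%:R^-1 : C) < 1.
  by rewrite invr_gt0 ltr0n /= invf_lt1 ?ltr0n // ltr1n.
apply: le_trans (@hval_dist z 2%:R^-1 1 n.+1 _ h01 isT) _.
  by apply: le_trans z8 _; rewrite lef_pV2 ?posrE ?ltr0n // ler_nat.
exact: half_bound.
Qed.

Lemma hval_neq0 z n : `|z| <= 8%:R^-1 -> hval n.+1 z != 0.
Proof.
move=> /hval_near1 - /(_ n); apply: contraTneq => ->.
by rewrite sub0r normrN normr1 -real_ltNge ?realE ?invr_ge0 ?ler0n ?ler01 // invf_lt1 ?ltr0n ?ltr1n.
Qed.

Lemma Hk_neq0_near0 z : `|z| <= 8%:R^-1 -> Hk t k z != 0.
Proof.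
move=> z8; have z1 : `|z| < 1.
  by apply: le_lt_trans z8 _; rewrite invf_lt1 ?ltr0n ?ltr1n.
have : `|Hk t k z - 1| <= 2%:R^-1.
  apply: (@tends_norm_le _ (fun n => hval n z - 1) _ _ 1).
    by apply: tendsD (tends_cst _); apply: Hk_tends.
  by case=> // n _; apply: hval_near1.
apply: contraTneq => ->.
by rewrite sub0r normrN normr1 -real_ltNge ?realE ?invr_ge0 ?ler0n ?ler01 // invf_lt1 ?ltr0n ?ltr1n.
Qed.
End Evaluation.

(** * The auxiliary function *)

Section Congruence.
Variables (A : comNzRingType) (m : nat).
Implicit Types x y : {poly A}.

Lemma zord_subM x x' y y' : zord m (x - x') -> zord m (y - y') ->
  zord m (x * y - x' * y').
Proof.
move=> zx zy; have -> : x * y - x' * y' = x * (y - y') + (x - x') * y' by ring.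
by apply: zordD; [apply: zordMl|apply: zordMr].
Qed.

Lemma zord_subX x x' n : zord m (x - x') -> zord m (x ^+ n - x' ^+ n).
Proof.
move=> zx; elim: n => [|n IH]; first by rewrite subrr; apply: zord0.
by rewrite !exprS; apply: zord_subM.
Qed.

Lemma zord_sub_form_eval d (p : {poly {poly A}}) x x' y y' :
  zord m (x - x') -> zord m (y - y') -> zord m (form_eval d p x y - form_eval d p x' y').
Proof.
move=> zx zy; rewrite /form_eval -sumrB; apply: big_ind => [||i _]; first exact: zord0.
  by move=> *; apply: zordD.
apply: zord_subM; last exact: zord_subX.
by apply: zord_subM; [rewrite subrr; apply: zord0|apply: zord_subX].
Qed.
End Congruence.

Section AuxiliaryFunction.
Variables t k : nat.
Hypothesis t_gt1 : (2 <= t)%N.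
Hypothesis k_gt0 : (1 <= k)%N.
Local Notation T := (t ^ k)%N.
Local Notation h := (hpoly t k).

Definition hform N (p : {poly {poly int}}) n : {poly int} :=
  form_eval N p (h n.+2) (h n.+1 \Po 'X^T).

(** Truncations of the power series [p(z; H(z), H(z^T))] have a common order
    of vanishing, which is finite because [H(z)/H(z^T)] is transcendental. *)
Lemma hform_order N (p : {poly {poly int}}) : p != 0 -> (size p <= N.+1)%N ->
  exists v c n0, c != 0 /\
    forall n, (n0 <= n)%N -> zord v (hform N p n) /\ (hform N p n)`_v = c.
Proof.
move=> p0 sp; pose hQ n : {poly rat} := map_poly intr (h n).
have T1 : (1 < T)%N := pow_gt1 t_gt1 k_gt0.
have T0 := ltnW T1.
have [e e2 eE] := stern_pow2_comp t_gt1 k_gt0.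
have [s [s0 sE]] := stern_pred_pow2_at1 t_gt1 k_gt0.
have compQ (q : {poly int}) : map_poly intr (q \Po 'X^T) =
    (map_poly intr q : {poly rat}) \Po 'X^T.
  by rewrite map_comp_poly map_polyXn.
pose aQ : {poly rat} := map_poly intr (stern t (2 ^ k - 1)).
have hQ_rec n : hQ n.+2 = aQ * (hQ n.+1 \Po 'X^T) +
    'X^e * ((hQ n \Po 'X^T) \Po 'X^T).
  rewrite /hQ hpoly_rec // rmorphD !rmorphM /= !compQ.
  by rewrite -!compQ eE map_polyXn.
have hQ0 n : (hQ n.+1)`_0 = 1 by rewrite coef_map /= hpoly_coef0.
have hQ_cauchy : zadic_cauchy hQ.
  move=> m; exists m => n mn i im; rewrite -rmorphB coef_map /=.
  by rewrite (hpoly_step t_gt1 k_gt0 (leq_trans im mn)).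
have aQ1 : aQ.[1] = s%:R.
  by rewrite -[1](rmorph1 (intr : {rmorphism int -> rat})) horner_map /= sE rmorph_nat.
pose pQ : {poly {poly rat}} := map_poly (map_poly intr) p.
have inj : injective (map_poly (intr : int -> rat)).
  by apply: map_inj_poly => //; apply: intr_inj.
have pQ0 : pQ != 0.
  by apply: contraNneq p0 => pQ0; apply/eqP/(map_inj_poly inj); rewrite ?rmorph0.
have spQ : (size pQ <= N.+1)%N := leq_trans (size_poly _ _) sp.
have nrel : ~ relation T hQ N pQ.
  by move=> /(no_relation T1 hQ_rec hQ0 hQ_cauchy s0 aQ1 spQ)/eqP; rewrite (negPf pQ0).
have formQ n : map_poly intr (hform N p n) = form_eval N pQ (xseq hQ n) (yseq T hQ n).
  by rewrite map_form_eval /= compQ.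
have [v [c [n0 [c0 vc]]]] := zadic_cauchy_val (zadic_cauchy_form_eval T0 hQ_cauchy N pQ) nrel.
have cE n : (n0 <= n)%N -> ((hform N p n)`_v)%:~R = c.
  by move=> /vc[_ <-]; rewrite -formQ coef_map.
exists v, (hform N p n0)`_v, n0; split.
  by apply: contraNneq c0 => c0; rewrite -(cE n0) // c0.
move=> n n0n; split; last by apply: (@intr_inj rat); rewrite !cE.
move=> i iv; apply: (@intr_inj rat); have [zn _] := vc n n0n.
by rewrite -[LHS]coef_map formQ zn.
Qed.

(** Vanishing is imposed on one truncation, of index [N ^ 2]; the later ones
    agree with it to that order. *)
Lemma hform_auxiliary N : exists (p : {poly {poly int}}) v c n0, [/\ (size p <= N.+1)%N,
  forall i, (size (p`_i)%R <= N.+1)%N, (N ^ 2 <= v)%N, c != 0 &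
  forall n, (n0 <= n)%N -> zord v (hform N p n) /\ (hform N p n)`_v = c].
Proof.
pose n1 := (N ^ 2)%N.
have [p [p0 sp spi zp]] := auxiliary_form N (h n1.+2) (h n1.+1 \Po 'X^T).
have [v [c [n0 [c0 vc]]]] := hform_order p0 sp.
exists p, v, c, n0; split=> //; rewrite leqNgt; apply/negP => vN.
pose n := maxn n0 n1.
have [_ cE] := vc n (leq_maxl _ _).
have n1n : (n1 <= n)%N by apply: leq_maxr.
have T0 : (0 < T)%N := ltnW (pow_gt1 t_gt1 k_gt0).
have : zord (N ^ 2) (hform N p n).
  rewrite -(subrK (hform N p n1) (hform N p n)); apply: zordD => //.
  apply: zord_sub_form_eval.
    by apply: zordW (hpoly_dist t_gt1 k_gt0 _); rewrite /n1; lia.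
  rewrite -comp_polyB; apply: zordW (zord_comp (hpoly_dist t_gt1 k_gt0 _)); last first.
    exact: (_ : n1.+1 <= n.+1)%N.
  by rewrite (leq_trans _ (leq_pmull _ _)) //; rewrite /n1; lia.
by move=> /(_ v vN)/eqP; rewrite cE (negPf c0).
Qed.

Variable C : numFieldType.
Hypothesis C_complete : geometrically_complete C.

Definition horner_int (z : C) : {rmorphism {poly int} -> C} :=
  horner_eval z \o map_poly intr.

(** The auxiliary function, of which [hform] gives polynomial truncations. *)
Definition hfun N (p : {poly {poly int}}) (z : C) : C :=
  form_eval N (map_poly (horner_int z) p) (Hk t k z) (Hk t k (z ^+ T)).

Lemma hfun_tends N p z : `|z| < 1 ->
  tends (fun n => horner_int z (hform N p n)) (hfun N p z).
Proof.
move=> z1; have T0 : (0 < T)%N := ltnW (pow_gt1 t_gt1 k_gt0).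
have zT1 : `|z ^+ T| < 1 by apply: norm_expT_lt1.
have := tends_form_eval N (map_poly (horner_int z) p)
  (tends_shift 2 (Hk_tends t_gt1 k_gt0 C_complete z1))
  (tends_shift 1 (Hk_tends t_gt1 k_gt0 C_complete zT1)).
congr tends; apply/funext => n; rewrite map_form_eval addn2 addn1; congr form_eval.
by rewrite /= /horner_eval map_comp_poly map_polyXn horner_comp hornerXn.
Qed.

Lemma wnorm_comp_hpoly (r : C) n : 0 <= r < 1 -> wnorm r (h n \Po 'X^T) <= (1 - r)^-1.
Proof.
move=> r01; have /andP[r0 _] := r01.
have T0 : (0 < T)%N := ltnW (pow_gt1 t_gt1 k_gt0).
apply: (le_trans _ (geometric_sum_le (size (h n \Po 'X^T)) r01)).
rewrite -[X in _ <= X]mul1r; apply: wnorm_le => // i.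
rewrite coef_comp_poly_Xn // -[X in _ <= X]/(1%:~R) ler_int; case: ifP => // _.
by have /andP[a0 a1] := stern_coef01 t_gt1 (alphan k n) (i %/ T); rewrite ger0_norm.
Qed.

Lemma wnorm_hform (r : C) N p : 0 <= r < 1 -> exists2 B, 0 < B &
  forall n, wnorm r (hform N p n) <= B.
Proof.
move=> r01; have /andP[r0 r1] := r01.
pose g := (1 - r)^-1; have g0 : 0 <= g by rewrite invr_ge0 subr_ge0 ltW.
exists (1 + \sum_(i < N.+1) wnorm r p`_i * g ^+ i * g ^+ (N - i)).
  rewrite ltr_pwDl // sumr_ge0 // => i _.
  by rewrite !mulr_ge0 ?exprn_ge0 ?wnorm_ge0.
move=> n; apply: (le_trans (wnorm_sum _ _ _ r0)).
rewrite -[X in X <= _]add0r lerD // ?ler01 //; apply: ler_sum => i _.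
have w0 q : 0 <= wnorm r q by apply: wnorm_ge0.
apply: (le_trans (wnormM _ _ r0)); apply: ler_pM => //.
  apply: (le_trans (wnormM _ _ r0)); rewrite ler_wpM2l //.
  apply: (le_trans (wnormX _ _ r0)); rewrite lerXn2r ?nnegrE //.
  by have := wnorm_hdiff t_gt1 k_gt0 0 n.+2 r01; rewrite hpoly0 subr0.
apply: (le_trans (wnormX _ _ r0)); rewrite lerXn2r ?nnegrE //.
exact: wnorm_comp_hpoly.
Qed.

(** A power series of exact order [v] with integral leading coefficient: the
    coefficients of all truncations are bounded by a fixed geometric series. *)
Lemma hfun_bounds N p v c n0 : c != 0 ->
  (forall n, (n0 <= n)%N -> zord v (hform N p n) /\ (hform N p n)`_v = c) ->
  exists B, [/\ 0 < B,
    forall z, `|z| <= 2%:R^-1 -> `|hfun N p z| <= B * `|z| ^+ v &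
    forall z, `|z| <= 2%:R^-1 -> z != 0 -> B * `|z| < 1 -> hfun N p z != 0].
Proof.
move=> c0 vc; pose r : C := 2%:R^-1.
have r0 : 0 < r by rewrite invr_gt0 ltr0n.
have r1 : r < 1 by rewrite invf_lt1 ?ltr0n ?ltr1n.
have r01 : 0 <= r < 1 by rewrite (ltW r0).
have [B B0 hB] := wnorm_hform N p r01.
have rz (z : C) : `|z| / r = 2%:R * `|z| by rewrite invrK mulrC.
have two_ge1 : 1 <= 2%:R :> C by rewrite ler1n.
exists (2%:R ^+ v.+1 * B); split; first by rewrite mulr_gt0 ?exprn_gt0 ?ltr0n.
  move=> z zr; apply: (@tends_norm_le _ _ _ _ n0 (hfun_tends N p (le_lt_trans zr r1))).
  move=> n /vc[zn _]; apply: (le_trans (horner_zord_le r0 zr zn)).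
  rewrite rz exprMn mulrAC ler_wpM2r ?exprn_ge0 //.
  by apply: ler_pM; rewrite ?exprn_ge0 ?wnorm_ge0 ?(ltW r0) ?ler_weXn2l ?hB.
move=> z zr z0 Bz; have nz0 : 0 < `|z| by rewrite normr_gt0.
suff : `|z| ^+ v * (1 - 2%:R ^+ v.+1 * B * `|z|) <= `|hfun N p z|.
  move=> le1; rewrite -normr_gt0; apply: lt_le_trans le1.
  by rewrite mulr_gt0 ?exprn_gt0 // subr_gt0.
apply: (@tends_norm_ge _ _ _ _ n0 (hfun_tends N p (le_lt_trans zr r1))).
move=> n /vc[zn cn]; pose q := hform N p n - c *: 'X^v.
have qE i : q`_i = if i == v then 0 else (hform N p n)`_i.
  rewrite coefB coefZ coefXn; case: eqP => [->|_]; first by rewrite cn mulr1 subrr.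
  by rewrite mulr0 subr0.
have zq : zord v.+1 q.
  move=> i; rewrite ltnS qE leq_eqVlt; case: eqP => //= _; exact: zn.
have qB : wnorm r q <= B.
  apply: le_trans (hB n); apply: wnorm_le_coef => [|i]; first exact: ltW.
  by rewrite qE; case: ifP => // _; rewrite normr0.
have qz : `|horner_int z q| <= 2%:R ^+ v.+1 * B * `|z| ^+ v.+1.
  apply: (le_trans (horner_zord_le r0 zr zq)).
  by rewrite rz exprMn mulrAC ler_wpM2r ?exprn_ge0 // ler_wpM2l ?exprn_ge0.
have hz : horner_int z (hform N p n) = c%:~R * z ^+ v + horner_int z q.
  have -> : hform N p n = c *: 'X^v + q by rewrite addrC subrK.
  rewrite rmorphD; congr (_ + _).
  by rewrite /horner_int /= /horner_eval map_polyZ map_polyXn hornerZ hornerXn.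
have c1 : 1 <= `|c%:~R| :> C by rewrite -intr_norm -[X in X <= _]/(1%:~R) ler_int; lia.
rewrite hz mulrBr mulr1 mulrCA -exprSr lerBlDr.
apply: (@le_trans _ _ `|c%:~R * z ^+ v|).
  by rewrite normrM normrX ler_peMl ?exprn_ge0.
rewrite -[X in `|X| <= _](addrK (horner_int z q)).
by apply: (le_trans (ler_normB _ _)); rewrite lerD2l.
Qed.
End AuxiliaryFunction.

(** * Mahler's argument *)

Section Mahler.
Variables (C : numFieldType) (t k : nat).
Hypothesis t_gt1 : (2 <= t)%N.
Hypothesis k_gt0 : (1 <= k)%N.
Hypothesis C_complete : geometrically_complete C.
Hypothesis C_small : forall x e : C, 0 <= x < 1 -> 0 < e ->
  exists N, forall n, (N <= n)%N -> x ^+ n < e.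
Local Notation T := (t ^ k)%N.

Variable alpha : C.
Hypothesis alpha_neq0 : alpha != 0.
Hypothesis alpha_lt1 : `|alpha| < 1.

(** Suppose that [(H(alpha), H(alpha^T))] is a multiple of a vector
    [(beta1, beta2)] of numbers that act integrally, up to denominators. *)
Variables (D : nat) (v : 'rV[C]_D) (m K c0 : nat) (beta1 beta2 : C).
Hypothesis D_gt0 : (0 < D)%N.
Hypothesis v_neq0 : v != 0.
Hypothesis m_K : (0 < m <= K)%N.
Hypothesis rep_alpha : irep v m K 1 1 alpha.
Hypothesis rep_beta1 : irep v m K 1 c0 beta1.
Hypothesis rep_beta2 : irep v m K 1 c0 beta2.

Variable mu : C.
Hypothesis mu_neq0 : mu != 0.
Hypothesis Hk1 : Hk t k alpha = mu * beta1.
Hypothesis Hk2 : Hk t k (alpha ^+ T) = mu * beta2.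

Definition orbit n : C := alpha ^+ (T ^ n).

Lemma orbitS n : orbit n.+1 = orbit n ^+ T.
Proof. by rewrite /orbit expnSr exprM. Qed.

Lemma orbit_neq0 n : orbit n != 0. Proof. exact: expf_neq0. Qed.

Lemma T_gt0 : (0 < T)%N. Proof. exact: ltnW (pow_gt1 t_gt1 k_gt0). Qed.

Lemma orbit_lt1 n : `|orbit n| < 1.
Proof. by apply: norm_expT_lt1 => //; rewrite expn_gt0 T_gt0. Qed.

Variable e : nat.
Hypothesis e_E : forall z : C, stern_at t (2 ^ k) (z ^+ T) = z ^+ e.

(** Solving the functional equation for the values at the next point of the
    orbit, without the division by [orbit n ^+ e], which [pullback_det]
    collects. *)
Fixpoint pullback n : C * C :=
  if n is n'.+1 then
    let: (x, y) := pullback n' in (orbit n' ^+ e * y, x - aval t k (orbit n') * y)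
  else (beta1, beta2).

Fixpoint pullback_det n : C := if n is n'.+1 then pullback_det n' * orbit n' ^+ e else 1.

Lemma pullback_det_neq0 n : pullback_det n != 0.
Proof. by elim: n => [|n IH] /=; rewrite ?oner_neq0 // mulf_neq0 ?expf_neq0 ?orbit_neq0. Qed.

Lemma pullback_det_le1 n : `|pullback_det n| <= 1.
Proof.
elim: n => [|n IH] /=; first by rewrite normr1.
rewrite normrM mulr_ile1 ?normr_ge0 // normrX exprn_ile1 ?normr_ge0 //.
exact/ltW/orbit_lt1.
Qed.

Lemma pullbackE n : mu * (pullback n).1 = pullback_det n * Hk t k (orbit n) /\
  mu * (pullback n).2 = pullback_det n * Hk t k (orbit n ^+ T).
Proof.
elim: n => [|n [IH1 IH2]] /=.
  by rewrite /orbit expn0 expr1 !mul1r Hk1 Hk2.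
case E: (pullback n) IH1 IH2 => [x y] /= IH1 IH2; rewrite orbitS; split.
  by rewrite mulrCA IH2; ring.
rewrite mulrBr mulrCA IH1 IH2.
have := Hk_eq t_gt1 k_gt0 C_complete (orbit_lt1 n) e_E.
by move=> ->; ring.
Qed.

(** Step [n] raises the exponent by at most a multiple of [T ^ n]; since [T] is at
    least 2, the sum stays below a multiple of the last term, while the factor
    grows only geometrically in [n]. *)
Lemma irep_pullback : exists J L, forall n,
  irep v m K (J * T ^ n) (c0 * L ^ n) (pullback n).1 /\
  irep v m K (J * T ^ n) (c0 * L ^ n) (pullback n).2.
Proof.
have /andP[m0 mK] := m_K.
pose A := stern t (2 ^ k - 1); pose E := (size A + e)%N; pose J := E.+1.
have sA : (size A <= E.+1)%N by rewrite /E; lia.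
pose LA := (\sum_(i < E.+1) D * `|(A`_i)%R| * D)%N.
have repA n : irep v m K (E * T ^ n) LA (aval t k (orbit n)).
  have := irep_horner D_gt0 mK sA rep_alpha (T ^ n).
  by rewrite muln1.
have rep_e n : irep v m K (E * T ^ n) D (orbit n ^+ e).
  rewrite /orbit -exprM; have := irepX (T ^ n * e) rep_alpha.
  rewrite exp1n !muln1 => r; apply: (irepW mK _ (leqnn _) r).
  by rewrite mulnC leq_mul2r /E leq_addl orbT.
pose L := (D + 1 + LA * D)%N; exists J, L.
elim=> [|n [IH1 IH2]].
  by rewrite expn0 muln1 muln1; split; apply: (irepW mK _ (leqnn _) rep_beta1) ||
    apply: (irepW mK _ (leqnn _) rep_beta2).
have le_e : (E * T ^ n + J * T ^ n <= J * T ^ n.+1)%N.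
  rewrite -mulnDl expnS [(J * _)%N in X in (_ <= X)%N]mulnA leq_mul2r; apply/orP; right.
  have := pow_gt1 t_gt1 k_gt0; rewrite /J; move: T => T' T1; nia.
have le_J : (J * T ^ n <= J * T ^ n.+1)%N by apply: leq_trans le_e; rewrite leq_addl.
rewrite /=; case Ep: (pullback n) IH1 IH2 => [x y] /= IH1 IH2.
have c_le c1 : (c1 <= L)%N -> (c1 * (c0 * L ^ n) <= c0 * L ^ n.+1)%N.
  by move=> c1L; rewrite expnS mulnCA leq_mul2l leq_mul2r c1L !orbT.
split.
  apply: (irepW mK le_e _ (irepM (rep_e n) IH2)); apply: c_le.
  by rewrite /L -addnA leq_addr.
have r1 := irepW mK le_J (leqnn _) IH1.
have r2 := irepW mK le_e (leqnn _) (irepN (irepM (repA n) IH2)).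
apply: (irepW mK (leqnn _) _ (irepD r1 r2)).
have -> : (c0 * L ^ n + LA * (c0 * L ^ n) * D = (1 + LA * D) * (c0 * L ^ n))%N.
  by move: (L ^ n)%N => l; ring.
by apply: c_le; rewrite /L -addnA leq_addl.
Qed.

(** The auxiliary form at the [n]-th point of the orbit, evaluated on the pulled
    back vector: an expression in [alpha], [beta1], [beta2], and at the same time
    a small multiple of the auxiliary function. *)
Definition pullback_form N (p : {poly {poly int}}) n : C :=
  form_eval N (map_poly (horner_int (orbit n)) p) (pullback n).1 (pullback n).2.

Lemma pullback_formE N p n :
  mu ^+ N * pullback_form N p n = pullback_det n ^+ N * hfun t k N p (orbit n).
Proof.
by rewrite /pullback_form -form_eval_scale (pullbackE n).1 (pullbackE n).2 form_eval_scale.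
Qed.

Lemma irep_pullback_form : exists J L, forall N (p : {poly {poly int}}), (size p <= N.+1)%N ->
  (forall i, (size (p`_i)%R <= N.+1)%N) -> exists c1, forall n,
  irep v m K (N * J * T ^ n) (c1 * (L ^ n) ^ N) (pullback_form N p n).
Proof.
have /andP[m0 mK] := m_K.
have [J [L rL]] := irep_pullback; exists J.+1, L => N p sp spi.
pose ci i := (\sum_(j < N.+1) D * `|(p`_i`_j)%R| * D)%N.
exists (\sum_(i < N.+1) ci i * (D * D * c0 ^ N))%N => n.
have [r1 r2] := rL n.
rewrite /pullback_form /form_eval big_distrl.
apply: (@irep_sum _ _ _ _ _ D_gt0 mK _ (fun i => ci i * (D * D * c0 ^ N) * (L ^ n) ^ N)%N
  (fun i => (map_poly (horner_int (orbit n)) p)`_i *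
    (pullback n).1 ^+ i * (pullback n).2 ^+ (N - i))).
move=> i iN; rewrite coef_map.
have ri : irep v m K (N * T ^ n) (ci i) (horner_int (orbit n) p`_i).
  by have := irep_horner D_gt0 mK (spi i) rep_alpha (T ^ n); rewrite muln1.
have r := irepM (irepM ri (irepX i r1)) (irepX (N - i) r2).
apply: (irepW mK _ _ r).
  by rewrite -addnA -mulnDl subnKC //; lia.
have -> : (ci i * (D * (c0 * L ^ n) ^ i) * (D * (c0 * L ^ n) ^ (N - i)) =
  ci i * (D * D * ((c0 * L ^ n) ^ i * (c0 * L ^ n) ^ (N - i))))%N.
  by move: ((c0 * L ^ n) ^ i)%N ((c0 * L ^ n) ^ (N - i))%N => x y; ring.
by rewrite -expnD subnKC // expnMn !mulnA.
Qed.

(** On the arithmetic side the form is at least of the size of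
    [G ^- (N * T ^ n)], where [G] is fixed before [N]; on the analytic side it is
    at most of the size of [`|alpha| ^+ (N ^ 2 * T ^ n)]. For large [N] the second
    is too small. *)
Lemma Mahler_contradiction : False.
Proof.
have /andP[m0 mK] := m_K.
have K0 : (0 < K)%N by apply: leq_trans mK.
have [J [L rL]] := irep_pullback_form.
pose L1 := L.+1; pose G := (L1 ^ D * (K ^ D.+1) ^ J)%N.
have T1 := pow_gt1 t_gt1 k_gt0.
have G0 : 0 < G%:R :> C by rewrite ltr0n muln_gt0 !expn_gt0 K0.
have na01 : 0 <= `|alpha| < 1 by rewrite normr_ge0.
have Ginv0 : 0 < G%:R^-1 :> C by rewrite invr_gt0.
have [N1 N1P] := C_small na01 Ginv0.
pose N := N1.+1.
have rho1 : G%:R * `|alpha| ^+ N < 1.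
  by rewrite -ltr_pdivlMl // mulr1; apply: N1P; rewrite /N.
pose rho := (G%:R * `|alpha| ^+ N) ^+ N.
have rho01 : 0 <= rho < 1.
  rewrite exprn_ge0 ?mulr_ge0 ?exprn_ge0 ?(ltW G0) //=.
  by rewrite exprn_ilt1 // ?mulr_ge0 ?exprn_ge0 ?(ltW G0).
have [p [w [c [n0 [sp spi Nw cn0 pw]]]]] := hform_auxiliary t_gt1 k_gt0 N.
have [c1 rc1] := rL N p sp spi.
have [B [B0 upper nonzero]] := hfun_bounds t_gt1 k_gt0 C_complete cn0 pw.
(* [Q] depends on [N], but [n] is chosen after both. *)
pose Q : C := `|mu| ^- N * B * (D`! * (1 + c1) ^ D)%:R.
have Q0 : 0 <= Q by rewrite !mulr_ge0 ?invr_ge0 ?exprn_ge0 ?ler0n ?(ltW B0).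
have half0 : 0 < 2%:R^-1 :> C by rewrite invr_gt0 ltr0n.
have [N2 N2P] := C_small na01 half0.
have Binv0 : 0 < B^-1 by rewrite invr_gt0.
have [N3 N3P] := C_small na01 Binv0.
have Qinv0 : 0 < (Q + 1)^-1 by rewrite invr_gt0 ltr_wpDl.
have [N4 N4P] := C_small rho01 Qinv0.
pose n := maxn N2 (maxn N3 N4).
have nT : (n < T ^ n)%N by apply: ltn_expl.
have zn : `|orbit n| = `|alpha| ^+ (T ^ n) by rewrite normrX.
have zn2 : `|orbit n| <= 2%:R^-1.
  by rewrite zn; apply/ltW/N2P/(leq_trans _ (ltnW nT)); rewrite leq_maxl.
have zn3 : B * `|orbit n| < 1.
  rewrite -ltr_pdivlMl // mulr1 zn; apply/N3P/(leq_trans _ (ltnW nT)).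
  by rewrite leq_max leq_maxl orbT.
have E0 := nonzero _ zn2 (orbit_neq0 n) zn3.
pose q := pullback_form N p n.
have qE : q = mu ^- N * (pullback_det n ^+ N * hfun t k N p (orbit n)).
  by rewrite -pullback_formE mulKf // expf_neq0.
have q0 : q != 0.
  by rewrite qE !mulf_neq0 ?invr_neq0 ?expf_neq0 ?pullback_det_neq0.
have q_le : `|q| <= `|mu| ^- N * B * `|orbit n| ^+ (N ^ 2)%N.
  rewrite qE normrM normfV normrX -mulrA ler_wpM2l ?invr_ge0 ?exprn_ge0 //.
  rewrite normrM normrX; apply: (@le_trans _ _ (1 * (B * `|orbit n| ^+ w))).
    by rewrite ler_pM ?exprn_ge0 ?exprn_ile1 ?pullback_det_le1 ?upper.
  rewrite mul1r ler_wpM2l ?(ltW B0) // ler_wiXn2l //.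
  exact/ltW/orbit_lt1.
have := irep_lower_bound v_neq0 m_K (rc1 n) q0; rewrite -/q => low.
suff : Q * rho ^+ (T ^ n) < 1.
  apply/negP; rewrite -real_leNgt ?real1 //; last first.
    by rewrite ger0_real // mulr_ge0 ?exprn_ge0 //; case/andP: rho01.
  apply: (le_trans low).
  have nat_le : (D`! * (1 + c1 * (L ^ n) ^ N) ^ D * (K ^ D.+1) ^ (N * J * T ^ n) <=
      D`! * (1 + c1) ^ D * G ^ (N * T ^ n))%N.
    have LL : ((L ^ n) ^ N <= L1 ^ (N * T ^ n))%N.
      rewrite mulnC expnM leq_exp2r //; apply: (@leq_trans (L1 ^ n)).
        by case: n {nT zn zn2 zn3 E0 q qE q0 q_le low} => // n; rewrite leq_exp2r.
      by rewrite leq_pexp2l // ltnW.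
    have LD : ((1 + c1 * (L ^ n) ^ N) ^ D <= (1 + c1) ^ D * (L1 ^ (N * T ^ n)) ^ D)%N.
      rewrite -expnMn leq_exp2r // mulnDl mul1n leq_add ?expn_gt0 //.
      by rewrite leq_mul2l LL orbT.
    have -> : (G ^ (N * T ^ n) =
        (L1 ^ (N * T ^ n)) ^ D * (K ^ D.+1) ^ (N * J * T ^ n))%N.
      rewrite /G expnMn -!expnM; congr (_ ^ _ * _ ^ _)%N; ring.
    by rewrite !mulnA leq_mul // -!mulnA leq_mul.
  rewrite -mulrA -natrM.
  apply: (le_trans (ler_wpM2r (ler0n _ _) q_le)).
  apply: (@le_trans _ _ (`|mu| ^- N * B * `|orbit n| ^+ (N ^ 2)%N *
      (D`! * (1 + c1) ^ D * G ^ (N * T ^ n))%:R)).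
    rewrite ler_wpM2l ?ler_nat // !mulr_ge0 ?invr_ge0 ?exprn_ge0 //.
    exact: ltW.
  rewrite le_eqVlt; apply/orP; left; apply/eqP.
  rewrite /Q /rho zn natrM natrX -!exprM exprMn -!exprM.
  have -> : (N * (N * T ^ n) = T ^ n * N ^ 2)%N by rewrite expnS expn1; ring.
  by rewrite -!mulrA; congr (_ * (_ * _)); rewrite mulrCA; congr (_ * _); rewrite mulrC.
apply: (@le_lt_trans _ _ ((Q + 1) * rho ^+ (T ^ n))).
  by rewrite ler_wpM2r ?lerDl ?exprn_ge0 //; case/andP: rho01.
rewrite -ltr_pdivlMl ?ltr_wpDl // mulr1; apply/N4P/(leq_trans _ (ltnW nT)).
by rewrite !leq_max leqnn !orbT.
Qed.
End Mahler.

(** * The continued fraction *)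

Section Independence.
Variables (C : numFieldType) (t k : nat).
Hypothesis t_gt1 : (2 <= t)%N.
Hypothesis k_gt0 : (1 <= k)%N.
Hypothesis C_complete : geometrically_complete C.
Hypothesis C_small : forall x e : C, 0 <= x < 1 -> 0 < e ->
  exists N, forall n, (N <= n)%N -> x ^+ n < e.
Local Notation T := (t ^ k)%N.

Lemma orbit_small (alpha : C) (e : C) : `|alpha| < 1 -> 0 < e ->
  exists J, forall j, (J <= j)%N -> `|orbit t k alpha j| <= e.
Proof.
move=> a1 e0; have a01 : 0 <= `|alpha| < 1 by rewrite normr_ge0.
have [J JP] := C_small a01 e0; exists J => j Jj; rewrite normrX; apply/ltW/JP.
exact: leq_trans Jj (ltnW (ltn_expl _ (pow_gt1 t_gt1 k_gt0))).
Qed.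

(** A linear relation with algebraic coefficients, including the vanishing of the
    second value, puts the vector of the two values on an algebraic line, which
    [Mahler_contradiction] excludes. The two values cannot both vanish, since
    then H would vanish along the whole orbit, which tends to 0. *)
Lemma Hk_independent (alpha : C) : algebraicOver ratr alpha -> alpha != 0 ->
  `|alpha| < 1 -> Hk t k (alpha ^+ T) != 0 /\
  forall beta, algebraicOver ratr beta -> Hk t k alpha <> beta * Hk t k (alpha ^+ T).
Proof.
move=> alg_alpha alpha0 alpha1; have [e _ [e_E _]] := hval_rec C t_gt1 k_gt0.
have contra := Mahler_contradiction t_gt1 k_gt0 C_complete C_small alpha0 alpha1.
have one8 : 0 < 8%:R^-1 :> C by rewrite invr_gt0 ltr0n.
have H2 : Hk t k (alpha ^+ T) != 0.
  apply/eqP => H20; have [H10|H10] := eqVneq (Hk t k alpha) 0.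
    have [J JP] := orbit_small alpha1 one8.
    have : Hk t k (orbit t k alpha J) = 0 /\ Hk t k (orbit t k alpha J.+1) = 0.
      elim: {JP} J => [|j [IH1 IH2]].
        by rewrite orbitS /orbit expn0 expr1.
      split=> //; have lt1 := orbit_lt1 t_gt1 k_gt0 alpha1 j.
      have := Hk_eq t_gt1 k_gt0 C_complete lt1 e_E.
      rewrite -!orbitS IH1 IH2 mulr0 add0r => /esym/eqP; rewrite mulf_eq0.
      by rewrite expf_eq0 (negPf (orbit_neq0 t k alpha0 j)) andbF => /eqP.
    by case=> /eqP; rewrite (negPf (Hk_neq0_near0 t_gt1 k_gt0 C_complete (JP J (leqnn J)))).
  have [D [v [m [K [D0 v0 mK ra _]]]]] := algebraic_pair_irep alg_alpha alg_alpha.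
  have /andP[_ mK'] := mK.
  have r1 : irep v m K 1 D (1 : C).
    have := irepC v m K 1; rewrite rmorph1 => r; apply: (irepW mK' _ _ r) => //.
    by rewrite muln1.
  have r0 : irep v m K 1 D (0 : C).
    have := irepC v m K 0; rewrite rmorph0 => r; apply: (irepW mK' _ _ r) => //.
    by rewrite muln0.
  apply: (contra D v m K D 1 0 D0 v0 mK ra r1 r0 _ H10 _ _ e e_E).
    by rewrite mulr1.
  by rewrite mulr0.
split=> // beta alg_beta HE.
have [D [v [m [K [D0 v0 mK ra rb]]]]] := algebraic_pair_irep alg_alpha alg_beta.
have /andP[_ mK'] := mK.
have r1 : irep v m K 1 D (1 : C).
  have := irepC v m K 1; rewrite rmorph1 => r; apply: (irepW mK' _ _ r) => //.
  by rewrite muln1.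
have rb' : irep v m K 1 D beta by apply: (irepW mK' _ _ rb).
apply: (contra D v m K D beta 1 D0 v0 mK ra rb' r1 _ H2 _ _ e e_E).
  by rewrite mulrC.
by rewrite mulr1.
Qed.

(** Dividing the recurrence by the value of the preceding polynomial at [z ^+ T]
    turns it into one step of the continued fraction. *)
Lemma cfrac_hval (alpha : C) e :
  (forall n (z : C), hval t k n.+2 z =
     aval t k z * hval t k n.+1 (z ^+ T) + z ^+ e * hval t k n ((z ^+ T) ^+ T)) ->
  forall n j (a b : nat -> C),
  (forall i, a i = aval t k (orbit t k alpha (j + i))) ->
  (forall i, b i.+1 = orbit t k alpha (j + i) ^+ e) ->
  (forall i, (i <= n)%N -> hval t k (n.+1 - i) (orbit t k alpha (j + i).+1) != 0) ->
  cfrac a b n = hval t k n.+2 (orbit t k alpha j) / hval t k n.+1 (orbit t k alpha j.+1)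
  /\ cfrac_defined a b n.
Proof.
move=> rec; elim=> [|n IH] j a b aE bE nz /=.
  by rewrite rec hval0 !hval1 mulr0 addr0 mulr1 divr1 aE addn0.
have [|||IH1 IH2] := IH j.+1 (fun i => a i.+1) (fun i => b i.+1).
- by move=> i; rewrite aE addSnnS.
- by move=> i; rewrite bE addSnnS.
- by move=> i iN; have := nz i.+1 iN; rewrite subSS addnS.
have n0 := nz 0%N isT; rewrite subn0 addn0 in n0.
have n1 := nz 1%N isT; rewrite subSS subn0 addn1 in n1.
rewrite IH1; split; last first.
  by split=> //; rewrite mulf_neq0 ?invr_neq0.
rewrite aE bE addn0 (rec n.+1) -!orbitS invf_div mulrDl mulfK //.
by rewrite mulrA.
Qed.

(** The denominators are values of approximating polynomials. Those at points
    close to 0 never vanish; at each of the finitely many other points of the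
    orbit they tend to a value of H, which is not 0 by [Hk_independent]. *)
Lemma cfrac_Hk (alpha : C) :
  algebraicOver ratr alpha -> alpha != 0 -> `|alpha| < 1 ->
  cfrac_value (fun n => aval t k (orbit t k alpha n))
    (fun n => stern_at t (2 ^ k) (orbit t k alpha n))
    (Hk t k alpha / Hk t k (alpha ^+ T)).
Proof.
move=> alg alpha0 alpha1.
have [e _ [e_E rec]] := hval_rec C t_gt1 k_gt0.
have alg_pow n : algebraicOver ratr (alpha ^+ n).
  elim: n => [|n IH]; first by rewrite expr0; apply: algebraic1.
  by rewrite exprS; apply: algebraic_mul.
have orb1 n : `|orbit t k alpha n| < 1 by apply: orbit_lt1.
have Hnz n : Hk t k (orbit t k alpha n.+1) != 0.
  have := Hk_independent (alg_pow (T ^ n)%N) (orbit_neq0 t k alpha0 n) (orb1 n).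
  by rewrite orbitS => -[].
have one8 : 0 < 8%:R^-1 :> C by rewrite invr_gt0 ltr0n.
have [J JP] := orbit_small alpha1 one8.
have early M : exists N, forall n, (N <= n)%N -> forall i, (i < M)%N ->
    hval t k (n.+1 - i) (orbit t k alpha i.+1) != 0.
  elim: M => [|M [N NP]]; first by exists 0%N.
  have [N' NP'] := tends_neq0 (Hk_tends t_gt1 k_gt0 C_complete (orb1 M.+1)) (Hnz M).
  exists (maxn N (N' + M))%N => n Nn i; rewrite ltnS leq_eqVlt => /predU1P[->|iM].
    by apply: NP'; lia.
  by apply: NP => //; lia.
have [N NP] := early J.
have nz n : (N <= n)%N -> forall i, (i <= n)%N ->
    hval t k (n.+1 - i) (orbit t k alpha (0 + i).+1) != 0.
  move=> Nn i ile; rewrite add0n; have [iJ|Ji] := ltnP i J; first exact: NP.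
  rewrite subSn //; apply: hval_neq0 => //; apply: JP; lia.
have main n : (N <= n)%N ->
    cfrac (fun n => aval t k (orbit t k alpha n))
      (fun n => stern_at t (2 ^ k) (orbit t k alpha n)) n =
      hval t k n.+2 alpha / hval t k n.+1 (alpha ^+ T) /\
    cfrac_defined (fun n => aval t k (orbit t k alpha n))
      (fun n => stern_at t (2 ^ k) (orbit t k alpha n)) n.
  move=> Nn; have bE i : stern_at t (2 ^ k) (orbit t k alpha i.+1) =
      orbit t k alpha (0 + i) ^+ e by rewrite add0n orbitS e_E.
  have [-> def_n] := @cfrac_hval alpha e rec n 0%N
    (fun n => aval t k (orbit t k alpha n))
    (fun n => stern_at t (2 ^ k) (orbit t k alpha n)) (fun=> erefl) bE (nz n Nn).
  by split=> //; rewrite orbitS /orbit expn0 expr1.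
split; first by exists N => // n /main[].
apply/tendsP; have T0 : (0 < T)%N := ltnW (pow_gt1 t_gt1 k_gt0).
have H0 : Hk t k (alpha ^+ T) != 0 by have := Hnz 0%N; rewrite /orbit expn1.
have := tendsM (tends_shift 2 (Hk_tends t_gt1 k_gt0 C_complete alpha1))
  (tendsV H0 (tends_shift 1 (Hk_tends t_gt1 k_gt0 C_complete (norm_expT_lt1 alpha1 T0)))).
move=> lim_hval ep /lim_hval[M MP]; exists (maxn N M) => n.
rewrite geq_max => /andP[Nn Mn]; have := MP n Mn.
by rewrite addn2 addn1 -(main n Nn).1.
Qed.
End Independence.

Local Open Scope complex_scope.

Theorem corollary1p1 (R : realType) (t k : nat) (ht : (2 <= t)%N)
    (hk : (1 <= k)%N) (alpha : R[i])
    (halg : algebraicOver (@ratr R[i]) alpha)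
    (halpha : 0 < `|alpha| < 1) :
  [/\ Hk t k (alpha ^+ (t ^ k)%N) != 0,
      cfrac_value (fun n => stern_at t (2 ^ k - 1)%N (alpha ^+ (t ^ (n * k))%N))
                  (fun n => stern_at t (2 ^ k)%N (alpha ^+ (t ^ (n * k))%N))
                  (Hk t k alpha / Hk t k (alpha ^+ (t ^ k)%N))
    & transcendental (Hk t k alpha / Hk t k (alpha ^+ (t ^ k)%N))].
Proof.
have complete : geometrically_complete R[i] by move=> u r K; apply: geometric_cvg.
have small := @expr_small R.
have [alpha0 alpha1] : alpha != 0 /\ `|alpha| < 1.
  by case/andP: halpha => a0 a1; rewrite -normr_gt0.
have [H0 indep] := Hk_independent ht hk complete small halg alpha0 alpha1.
split=> //.
  have orbE n : alpha ^+ (t ^ (n * k))%N = orbit t k alpha n.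
    by rewrite /orbit -expnM mulnC.
  rewrite (_ : (fun n => stern_at t (2 ^ k - 1) _) = fun n => aval t k (orbit t k alpha n)).
    rewrite (_ : (fun n => stern_at t (2 ^ k) _) = fun n => stern_at t (2 ^ k) (orbit t k alpha n)).
      exact: cfrac_Hk.
    by apply/funext => n; rewrite orbE.
  by apply/funext => n; rewrite orbE.
by move=> alg; apply: (indep _ alg); rewrite divfK.
Qed.
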